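(* Let $v,a,b,c\in\mathbb{C}$ with $\Re(v)<1$, $\Re(c)>0$, and $\Re(vc+a+b)>0$, $\Re(vc+a-b)>0$, $\Re(vc-a+b)>0$, $\Re(vc-a-b)>0$. Fix a square root $\sqrt{a^2+b^2}$ and put $\lambda_1=\frac v2-\frac{\sqrt{a^2+b^2}}{2c}$, $\lambda_2=\frac v2+\frac{\sqrt{a^2+b^2}}{2c}$, $\sigma_3=\frac v2-\frac{a}{2c}-\frac{b}{2c}$, $\sigma_4=\frac v2-\frac{a}{2c}+\frac{b}{2c}$, $\sigma_5=\frac v2+\frac{a}{2c}+\frac{b}{2c}$, $\sigma_6=\frac v2+\frac{a}{2c}-\frac{b}{2c}$, $P=(vc-a-b)(vc+a+b)(vc-a+b)(vc+a-b)$; assume $\frac v2,\lambda_1,\lambda_2\notin\mathbb{Z}_0^-$ and $1+\sigma_j\notin\mathbb{Z}_0^-$ ($j=3,4,5,6$). Then $$ \int_0^\infty\frac{\cosh(ax)\cosh(bx)}{\sinh^{v}(cx)}\,dx=\frac{2^{v}(v^3c^3-a^2vc-b^2vc)}{P}\;{}_8F_7\!\left(\begin{matrix}v,\ 1+\frac v2,\ 1+\lambda_1,\ 1+\lambda_2,\ \sigma_3,\ \sigma_4,\ \sigma_5,\ \sigma_6\\ \frac v2,\ \lambda_1,\ \lambda_2,\ 1+\sigma_3,\ 1+\sigma_4,\ 1+\sigma_5,\ 1+\sigma_6\end{matrix};\,1\right). $$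
   Context: $\mathbb{Z}_0^-=\{0,-1,-2,\dots\}$. The Pochhammer symbol is $(\lambda)_0=1$, $(\lambda)_n=\lambda(\lambda+1)\cdots(\lambda+n-1)$ for $n\ge1$. The generalized hypergeometric series is ${}_pF_q\!\left(\begin{matrix}\alpha_1,\dots,\alpha_p\\ \beta_1,\dots,\beta_q\end{matrix};z\right)=\sum_{n=0}^\infty\frac{(\alpha_1)_n\cdots(\alpha_p)_n}{(\beta_1)_n\cdots(\beta_q)_n}\frac{z^n}{n!}$ (with no $\beta_j\in\mathbb{Z}_0^-$); when $p=q+1$ and $z=1$ it converges if $\Re(\sum\beta_j-\sum\alpha_i)>0$. For $\Re(c)>0$ and $x>0$, the complex power $\sinh^{v}(cx)$ means $2^{-v}e^{vcx}(1-e^{-2cx})^{v}$, with the principal branch of $(1-e^{-2cx})^{v}$ (this agrees with the ordinary real power when $c>0$ and $v$ is real). *)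

(* Defs.v *)
From Stdlib Require Import Reals Lra List Arith.
Import ListNotations.
Open Scope R_scope.

Definition Cpx : Type := (R * R)%type.
Definition Cre (z : Cpx) : R := fst z.
Definition Cim (z : Cpx) : R := snd z.
Definition RtoC (x : R) : Cpx := (x, 0).
Definition Cadd (z w : Cpx) : Cpx := (fst z + fst w, snd z + snd w).
Definition Copp (z : Cpx) : Cpx := (- fst z, - snd z).
Definition Csub (z w : Cpx) : Cpx := Cadd z (Copp w).
Definition Cmul (z w : Cpx) : Cpx :=
  (fst z * fst w - snd z * snd w, fst z * snd w + snd z * fst w).
Definition Cinv (z : Cpx) : Cpx :=
  (fst z / (fst z ^ 2 + snd z ^ 2), - snd z / (fst z ^ 2 + snd z ^ 2)).
Definition Cdiv (z w : Cpx) : Cpx := Cmul z (Cinv w).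
Definition Cnorm (z : Cpx) : R := sqrt (fst z ^ 2 + snd z ^ 2).

Declare Scope cpx_scope.
Delimit Scope cpx_scope with Cx.
Infix "+" := Cadd : cpx_scope.
Infix "-" := Csub : cpx_scope.
Infix "*" := Cmul : cpx_scope.
Infix "/" := Cdiv : cpx_scope.
Notation "- z" := (Copp z) : cpx_scope.

Definition Cexp (z : Cpx) : Cpx := (exp (fst z) * cos (snd z), exp (fst z) * sin (snd z)).

(* principal argument in (-PI, PI] *)
Definition Carg (z : Cpx) : R :=
  let x := fst z in let y := snd z in
  match Rlt_dec 0 x with
  | left _ => atan (y / x)
  | right _ =>
    match Rlt_dec x 0 with
    | left _ => match Rle_dec 0 y with
                | left _ => atan (y / x) + PI
                | right _ => atan (y / x) - PI
                end
    | right _ =>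
      match Rlt_dec 0 y with
      | left _ => PI / 2
      | right _ => match Rlt_dec y 0 with
                   | left _ => - (PI / 2)
                   | right _ => 0
                   end
      end
    end
  end.

(* principal logarithm and principal power z^w = exp (w Log z) (0^w := 0) *)
Definition Clog (z : Cpx) : Cpx := (ln (Cnorm z), Carg z).
Definition Cpow (z w : Cpx) : Cpx :=
  match Req_EM_T (fst z) 0, Req_EM_T (snd z) 0 with
  | left _, left _ => (0, 0)
  | _, _ => Cexp (Cmul w (Clog z))
  end.

Definition Ccosh (z : Cpx) : Cpx := Cdiv (Cadd (Cexp z) (Cexp (Copp z))) (RtoC 2).

(* sinh^v(c x) := 2^{-v} e^{v c x} (1 - e^{-2 c x})^v, principal branch *)
Definition sinh_pow (c v : Cpx) (x : R) : Cpx :=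
  Cmul (Cmul (Cpow (RtoC 2) (Copp v)) (Cexp (Cmul v (Cmul c (RtoC x)))))
       (Cpow (Csub (RtoC 1) (Cexp (Cmul (RtoC (-2)) (Cmul c (RtoC x))))) v).

Fixpoint poch (z : Cpx) (n : nat) : Cpx :=
  match n with
  | O => RtoC 1
  | S m => Cmul (poch z m) (Cadd z (RtoC (INR m)))
  end.

Fixpoint Cpown (z : Cpx) (n : nat) : Cpx :=
  match n with O => RtoC 1 | S m => Cmul (Cpown z m) z end.

Definition prod_poch (l : list Cpx) (n : nat) : Cpx :=
  fold_right (fun a acc => Cmul (poch a n) acc) (RtoC 1) l.

Definition hyper_term (al be : list Cpx) (z : Cpx) (n : nat) : Cpx :=
  Cdiv (Cmul (prod_poch al n) (Cpown z n))
       (Cmul (prod_poch be n) (RtoC (INR (Factorial.fact n)))).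

Fixpoint Cpartial (u : nat -> Cpx) (n : nat) : Cpx :=
  match n with
  | O => u O
  | S m => Cadd (Cpartial u m) (u (S m))
  end.

Definition Cseries_cv (u : nat -> Cpx) (S : Cpx) : Prop :=
  Un_cv (fun n => fst (Cpartial u n)) (fst S) /\
  Un_cv (fun n => snd (Cpartial u n)) (snd S).

Definition hyperF_eq (al be : list Cpx) (z S : Cpx) : Prop :=
  Cseries_cv (hyper_term al be z) S.

Definition not_Z0neg (z : Cpx) : Prop := forall k : nat, z <> RtoC (- INR k).

Definition improper_int_0_inf (f : R -> Cpx) (L : Cpx) : Prop :=
  forall eps : R, 0 < eps ->
  exists d M : R, 0 < d /\ 0 < M /\
  forall u w : R, 0 < u -> u < d -> M < w -> u < w ->
    exists (pr1 : Riemann_integrable (fun x => fst (f x)) u w)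
           (pr2 : Riemann_integrable (fun x => snd (f x)) u w),
      Cnorm (Csub (RiemannInt pr1, RiemannInt pr2) L) < eps.

(* Main.v *)
From Coquelicot Require Import Coquelicot.
Require Import Defs.
From Stdlib Require Import Reals List Arith Factorial Lra Lia.
Import ListNotations.
Open Scope R_scope.

(** Write [A_n = (v)_n / n!]. The product of the two hyperbolic cosines is a sum of
    four exponentials, so with [mu = vc ± a ± b] the integrand is [2^v / 4] times
    the sum of the four functions
    [e^(-mu x) (1 - e^(-2cx))^(-v) = sum_n A_n e^(-(mu + 2nc) x)].
    The binomial series converges uniformly on compact subsets of the open disc,
    hence may be integrated termwise over [[u, w]] with [0 < u]. The resulting
    series in [u] and [w] is dominated by a multiple of [|A_n| / (n+1)], which is
    summable because [|A_n| - |A_(n+1)|] is eventually at least a positive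
    multiple of it when [Re v < 1]. Letting [u -> 0] and [w -> oo] gives
    [sum_n A_n / (mu + 2nc)], and adding the four partial fractions produces the
    general term of the hypergeometric series. *)

(** The parameters of the series are explained by [w = (v + 2n)c]. Adding [2nc] to each exponent
    [mu] replaces [vc] by [w], and the four reciprocals of [w ± a ± b] add up to
    [4w(w^2 - a^2 - b^2)] over the product of the four. Since [(1 + z)_n / (z)_n = (z + n)/z], the
    pair at [v/2] supplies the factor [w], the pairs at [lam1] and [lam2] supply
    [(w - s)(w + s) = w^2 - a^2 - b^2], and the inverted pairs at the [sig] supply the four
    denominators. The values at [n = 0] make up the prefactor.

    The obstacle is the endpoint 0: for [0 < Re v < 1] the sum of [|A_n|] diverges, so nothing is
    uniform up to [x = 0], and only the division by [mu + 2nc] restores summability. This is why the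
    integral is first cut at [u > 0]. The binomial theorem for complex [v] is drawn from its
    differential equation, and convergence of the series at 1, which is not assumed, comes out on
    the way. *)

(** * Field structure, modulus and exponential of complex numbers *)

Lemma Cpx_field_theory :
  field_theory (RtoC 0) (RtoC 1) Cadd Cmul Csub Copp Cdiv Cinv eq.
Proof. exact C_field_theory. Qed.
Add Field Cpx_field : Cpx_field_theory.

Lemma Cpx_eq (z w : Cpx) : fst z = fst w -> snd z = snd w -> z = w.
Proof. destruct z, w; simpl; intros -> ->; reflexivity. Qed.

Lemma Cnorm_mul z w : Cnorm (z * w)%Cx = Cnorm z * Cnorm w.
Proof. exact (Cmod_mult z w). Qed.

Lemma Cnorm_div z w : w <> RtoC 0 -> Cnorm (z / w)%Cx = Cnorm z / Cnorm w.
Proof. exact (Cmod_div z w). Qed.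

Lemma Cnorm_triangle z w : Cnorm (z + w)%Cx <= Cnorm z + Cnorm w.
Proof. exact (Cmod_triangle z w). Qed.

Lemma Cnorm_opp z : Cnorm (- z)%Cx = Cnorm z.
Proof. exact (Cmod_opp z). Qed.

Lemma Cnorm_ge0 z : 0 <= Cnorm z.
Proof. exact (Cmod_ge_0 z). Qed.

Lemma Cnorm_gt0 z : z <> RtoC 0 -> 0 < Cnorm z.
Proof. exact (proj1 (Cmod_gt_0 z)). Qed.

Lemma Cnorm_RtoC x : Cnorm (RtoC x) = Rabs x.
Proof. exact (Cmod_R x). Qed.

Lemma Rabs_fst_le z : Rabs (fst z) <= Cnorm z.
Proof. eapply Rle_trans; [apply Rmax_l | apply (Rmax_Cmod z)]. Qed.

Lemma Rabs_snd_le z : Rabs (snd z) <= Cnorm z.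
Proof. eapply Rle_trans; [apply Rmax_r | apply (Rmax_Cmod z)]. Qed.

Lemma Cnorm_le_add z : Cnorm z <= Rabs (fst z) + Rabs (snd z).
Proof.
  replace z with (RtoC (fst z) + (0, snd z))%Cx at 1
    by (apply Cpx_eq; simpl; ring).
  eapply Rle_trans; [apply Cnorm_triangle |].
  rewrite Cnorm_RtoC.
  replace (Cnorm (0, snd z)) with (Rabs (snd z)); [lra |].
  unfold Cnorm; simpl fst; simpl snd.
  rewrite <- sqrt_Rsqr_abs; f_equal; unfold Rsqr; ring.
Qed.

Lemma Cnorm_pown z n : Cnorm (Cpown z n) = Cnorm z ^ n.
Proof.
  induction n as [|n IH]; simpl.
  - rewrite Cnorm_RtoC; apply Rabs_R1.
  - rewrite Cnorm_mul, IH; ring.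
Qed.

Lemma Cexp_add z w : Cexp (z + w)%Cx = (Cexp z * Cexp w)%Cx.
Proof.
  apply Cpx_eq; simpl; rewrite exp_plus, ?cos_plus, ?sin_plus; ring.
Qed.

Lemma Cexp_0 : Cexp (RtoC 0) = RtoC 1.
Proof. apply Cpx_eq; simpl; rewrite exp_0, ?cos_0, ?sin_0; ring. Qed.

Lemma Cnorm_exp z : Cnorm (Cexp z) = exp (fst z).
Proof.
  unfold Cnorm; simpl fst; simpl snd.
  replace (_ + _) with (Rsqr (exp (fst z))).
  - apply sqrt_Rsqr; left; apply exp_pos.
  - generalize (sin2_cos2 (snd z)); unfold Rsqr; intros H.
    transitivity (exp (fst z) * exp (fst z) *
      (sin (snd z) * sin (snd z) + cos (snd z) * cos (snd z)));
      [rewrite H; ring | ring].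
Qed.

Lemma RtoC_neq0 x : x <> 0 -> RtoC x <> RtoC 0.
Proof. intros H E; apply H; exact (f_equal fst E). Qed.

Lemma fst_neq0 (z : Cpx) : 0 < fst z -> z <> RtoC 0.
Proof. intros H E; rewrite E in H; simpl in H; lra. Qed.

Lemma Cexp_neq0 z : Cexp z <> RtoC 0.
Proof.
  intros H; generalize (exp_pos (fst z)); rewrite <- Cnorm_exp, H.
  rewrite Cnorm_RtoC, Rabs_R0; lra.
Qed.

Lemma Cexp_opp z : Cexp (- z)%Cx = (RtoC 1 / Cexp z)%Cx.
Proof.
  assert (E : (Cexp z * Cexp (- z))%Cx = RtoC 1).
  { rewrite <- Cexp_add, <- Cexp_0; f_equal; ring. }
  rewrite <- E; field; apply Cexp_neq0.
Qed.

Lemma Cexp_mul_nat z n : Cexp (RtoC (INR n) * z)%Cx = Cpown (Cexp z) n.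
Proof.
  induction n as [|n IH]; [simpl|].
  - rewrite <- Cexp_0; f_equal; apply Cpx_eq; simpl; ring.
  - change (Cpown (Cexp z) (S n)) with (Cpown (Cexp z) n * Cexp z)%Cx.
    rewrite <- IH, <- Cexp_add; f_equal; rewrite S_INR; apply Cpx_eq; simpl; ring.
Qed.

(** * Derivatives of complex functions of a real variable *)

(** Componentwise, because the integral of the theorem is componentwise and the real mean value
    theorem and fundamental theorem then apply to each part. *)
Definition is_Cderive (f : R -> Cpx) (t : R) (l : Cpx) : Prop :=
  is_derive (fun x => fst (f x)) t (fst l) /\
  is_derive (fun x => snd (f x)) t (snd l).

Lemma is_Cderive_eq f t l l' : is_Cderive f t l -> l = l' -> is_Cderive f t l'.
Proof. intros H <-; exact H. Qed.

Lemma is_Cderive_const k t : is_Cderive (fun _ => k) t (RtoC 0).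
Proof. split; simpl; auto_derive; auto. Qed.

Lemma is_Cderive_RtoC t : is_Cderive RtoC t (RtoC 1).
Proof. split; simpl; auto_derive; auto. Qed.

(* [auto_derive] leaves [Derive (fun x => f x) t], in eta-expanded form. *)
Ltac rewrite_derive H :=
  match type of H with
  | is_derive ?f _ _ => rewrite (is_derive_unique (fun x : R => f x) _ _ H)
  end.

Lemma is_Cderive_add f g t l m : is_Cderive f t l -> is_Cderive g t m ->
  is_Cderive (fun x => f x + g x)%Cx t (l + m)%Cx.
Proof.
  assert (D : forall f1 g1 : R -> R, forall l1 m1 : R,
    is_derive f1 t l1 -> is_derive g1 t m1 ->
    is_derive (fun x => f1 x + g1 x) t (l1 + m1)).
  { intros f1 g1 l1 m1 H1 H2; auto_derive.
    - repeat split; eexists; eassumption.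
    - rewrite_derive H1; rewrite_derive H2; ring. }
  intros [Hf1 Hf2] [Hg1 Hg2]; split.
  - exact (D _ _ _ _ Hf1 Hg1).
  - exact (D _ _ _ _ Hf2 Hg2).
Qed.

Lemma is_Cderive_sub f g t l m : is_Cderive f t l -> is_Cderive g t m ->
  is_Cderive (fun x => f x - g x)%Cx t (l - m)%Cx.
Proof.
  intros Hf [Hg1 Hg2]; apply (is_Cderive_add f (fun x => - g x)%Cx); [exact Hf |].
  split; [exact (is_derive_opp (V := R_NormedModule) _ _ _ Hg1)
        | exact (is_derive_opp (V := R_NormedModule) _ _ _ Hg2)].
Qed.

Lemma is_Cderive_mul f g t l m : is_Cderive f t l -> is_Cderive g t m ->
  is_Cderive (fun x => f x * g x)%Cx t (l * g t + f t * m)%Cx.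
Proof.
  assert (D : forall f1 f2 g1 g2 : R -> R, forall l1 l2 m1 m2 : R,
    is_derive f1 t l1 -> is_derive f2 t l2 ->
    is_derive g1 t m1 -> is_derive g2 t m2 ->
    is_derive (fun x => f1 x * g1 x - f2 x * g2 x) t
      (l1 * g1 t - l2 * g2 t + (f1 t * m1 - f2 t * m2)) /\
    is_derive (fun x => f1 x * g2 x + f2 x * g1 x) t
      (l1 * g2 t + l2 * g1 t + (f1 t * m2 + f2 t * m1))).
  { intros f1 f2 g1 g2 l1 l2 m1 m2 H1 H2 H3 H4; split; auto_derive;
      try (repeat split; eexists; eassumption);
      rewrite_derive H1; rewrite_derive H2; rewrite_derive H3; rewrite_derive H4; ring. }
  intros [Hf1 Hf2] [Hg1 Hg2]; exact (D _ _ _ _ _ _ _ _ Hf1 Hf2 Hg1 Hg2).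
Qed.

Lemma is_Cderive_exp f t l : is_Cderive f t l ->
  is_Cderive (fun x => Cexp (f x)) t (l * Cexp (f t))%Cx.
Proof.
  assert (D : forall f1 f2 : R -> R, forall l1 l2 : R,
    is_derive f1 t l1 -> is_derive f2 t l2 ->
    is_derive (fun x => exp (f1 x) * cos (f2 x)) t
      (l1 * (exp (f1 t) * cos (f2 t)) - l2 * (exp (f1 t) * sin (f2 t))) /\
    is_derive (fun x => exp (f1 x) * sin (f2 x)) t
      (l1 * (exp (f1 t) * sin (f2 t)) + l2 * (exp (f1 t) * cos (f2 t)))).
  { intros f1 f2 l1 l2 H1 H2; split; auto_derive;
      try (repeat split; eexists; eassumption);
      rewrite_derive H1; rewrite_derive H2; ring. }
  intros [Hf1 Hf2]; exact (D _ _ _ _ Hf1 Hf2).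
Qed.

(** The principal logarithm on the right half-plane, where one formula without case distinction can
    be differentiated. Every base [1 - q] with [|q| < 1] lies there. *)
Definition Clog_rhp (z : Cpx) : Cpx := (ln (Cnorm z), atan (snd z / fst z)).

Lemma Clog_eq z : 0 < fst z -> Clog z = Clog_rhp z.
Proof.
  intros H; unfold Clog, Carg, Clog_rhp; destruct (Rlt_dec 0 (fst z)); [reflexivity | lra].
Qed.

Lemma is_Cderive_log f t l : 0 < fst (f t) -> is_Cderive f t l ->
  is_Cderive (fun x => Clog_rhp (f x)) t (l / f t)%Cx.
Proof.
  assert (D : forall f1 f2 : R -> R, forall l1 l2 : R, 0 < f1 t ->
    is_derive f1 t l1 -> is_derive f2 t l2 ->
    is_derive (fun x => ln (sqrt (f1 x ^ 2 + f2 x ^ 2))) t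
      (l1 * (f1 t / (f1 t ^ 2 + f2 t ^ 2)) - l2 * (- f2 t / (f1 t ^ 2 + f2 t ^ 2))) /\
    is_derive (fun x => atan (f2 x / f1 x)) t
      (l1 * (- f2 t / (f1 t ^ 2 + f2 t ^ 2)) + l2 * (f1 t / (f1 t ^ 2 + f2 t ^ 2)))).
  { intros f1 f2 l1 l2 Hp H1 H2.
    assert (Hn : 0 < f1 t ^ 2 + f2 t ^ 2) by nra.
    split; auto_derive.
    - repeat split; try (eexists; eassumption); simpl in Hn; try lra.
      apply sqrt_lt_R0; lra.
    - rewrite_derive H1; rewrite_derive H2.
      assert (Hs := sqrt_sqrt (f1 t ^ 2 + f2 t ^ 2) ltac:(lra)); simpl in Hs, Hn |- *.
      (* The root occurs only as [r * r] once fractions are combined, so [Hs] eliminates it. *)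
      set (r := sqrt _) in *; assert (r <> 0) by (intros E; rewrite E in Hs; lra).
      transitivity ((l1 * f1 t + l2 * f2 t) / (r * r)); [field; auto |].
      rewrite Hs; field; lra.
    - repeat split; try (eexists; eassumption); lra.
    - rewrite_derive H1; rewrite_derive H2.
      simpl in Hn; field; repeat split; nra. }
  intros Hp [Hf1 Hf2]; exact (D _ _ _ _ Hp Hf1 Hf2).
Qed.

(** The mean value theorem holds for each component, with different intermediate points; adding the
    two estimates costs the factor 2. *)
Lemma Cderive_increment f f' K :
  (forall t, 0 <= t <= 1 -> is_Cderive f t (f' t)) ->
  (forall t, 0 <= t <= 1 -> Cnorm (f' t) <= K) ->
  Cnorm (f 1 - f 0)%Cx <= 2 * K.
Proof.
  intros Hd Hb.
  assert (MV : forall g g' : R -> R,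
    (forall t, 0 <= t <= 1 -> is_derive g t (g' t)) ->
    (forall t, 0 <= t <= 1 -> Rabs (g' t) <= K) -> Rabs (g 1 - g 0) <= K).
  { intros g g' H H'.
    destruct (MVT_gen g 0 1 g') as [x [Hx E]].
    - intros t Ht; apply H; rewrite Rmin_left, Rmax_right in Ht; lra.
    - intros t Ht; apply continuity_pt_filterlim.
      apply (ex_derive_continuous g); exists (g' t); apply H.
      rewrite Rmin_left, Rmax_right in Ht; lra.
    - rewrite E; rewrite Rmin_left, Rmax_right in Hx by lra.
      replace (g' x * (1 - 0)) with (g' x) by ring; now apply H'. }
  eapply Rle_trans; [apply Cnorm_le_add |].
  assert (H1 := MV (fun x => fst (f x)) (fun x => fst (f' x))).
  assert (H2 := MV (fun x => snd (f x)) (fun x => snd (f' x))).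
  simpl in *.
  enough (Rabs (fst (f 1) - fst (f 0)) <= K /\ Rabs (snd (f 1) - snd (f 0)) <= K)
    by (unfold Rminus in *; lra).
  split; [apply H1 | apply H2]; intros t Ht; try (now apply Hd).
  - eapply Rle_trans; [apply Rabs_fst_le | now apply Hb].
  - eapply Rle_trans; [apply Rabs_snd_le | now apply Hb].
Qed.

(** * Binomial coefficients: boundedness and summability *)

Definition binc (v : Cpx) (n : nat) : Cpx := (poch v n / RtoC (INR (fact n)))%Cx.

Lemma RtoC_INR_neq0 n : n <> 0%nat -> RtoC (INR n) <> RtoC 0.
Proof. intros H; apply RtoC_neq0; now apply not_0_INR. Qed.

Lemma RtoC_mul x y : RtoC (x * y) = (RtoC x * RtoC y)%Cx.
Proof. apply Cpx_eq; simpl; ring. Qed.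

Lemma RtoC_S n : RtoC (INR (S n)) = (RtoC (INR n) + RtoC 1)%Cx.
Proof. rewrite S_INR; apply Cpx_eq; simpl; ring. Qed.

Lemma binc_0 v : binc v 0 = RtoC 1.
Proof. unfold binc; simpl; field; apply RtoC_neq0; lra. Qed.

Lemma binc_S v n :
  (RtoC (INR (S n)) * binc v (S n) = (v + RtoC (INR n)) * binc v n)%Cx.
Proof.
  unfold binc; rewrite fact_simpl, mult_INR, RtoC_mul.
  change (poch v (S n)) with (poch v n * (v + RtoC (INR n)))%Cx.
  field; split; apply RtoC_INR_neq0; [apply fact_neq_0 | lia].
Qed.

Lemma Cnorm_binc_S v n :
  INR (S n) * Cnorm (binc v (S n)) = Cnorm (v + RtoC (INR n))%Cx * Cnorm (binc v n).
Proof.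
  rewrite <- Cnorm_mul, <- binc_S, Cnorm_mul, Cnorm_RtoC, Rabs_pos_eq; [reflexivity |].
  apply pos_INR.
Qed.

Lemma sum_nonneg_mono (a : nat -> R) n m :
  (forall k, 0 <= a k) -> (n <= m)%nat -> sum_f_R0 a n <= sum_f_R0 a m.
Proof.
  intros H; induction 1; simpl; [lra | specialize (H (S m)); lra].
Qed.

Lemma term_le_sum (a : nat -> R) n :
  (forall k, 0 <= a k) -> a n <= sum_f_R0 a n.
Proof.
  intros H; destruct n; simpl; [lra |].
  assert (0 <= sum_f_R0 a n) by now apply cond_pos_sum. lra.
Qed.

(** For large [n], [|v + n|] is close to [n + Re v], which stays below [n + 1] by [1 - Re v]. Half
    of this gap is given up to absorb the contribution of the imaginary part. *)
Lemma Cnorm_shift_le v : Cre v < 1 -> exists N, forall n, (N <= n)%nat ->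
  Cnorm (v + RtoC (INR n))%Cx <= INR (S n) - (1 - Cre v) / 2.
Proof.
  destruct v as [x y]; unfold Cre; simpl fst; intros Hx.
  set (d := (1 - x) / 2).
  assert (Hd : 0 < d) by (unfold d; lra).
  (* The difference of the squares is [d (2n + x + (1 + x)/2) - y^2]: the summand [y^2 / d] pays for
     [y^2], the others for the terms in [x] and for the sign of the right-hand side. *)
  destruct (INR_unbounded (y ^ 2 / d + 2 * Rabs x + 2)) as [N HN].
  exists N; intros n Hn; apply le_INR in Hn; rewrite S_INR.
  assert (Hy : 0 <= y ^ 2 / d).
  { apply Rmult_le_pos; [apply pow2_ge_0 | left; now apply Rinv_0_lt_compat]. }
  assert (Hab := Rabs_maj2 x); assert (Hab' := Rle_abs x).
  unfold Cnorm; simpl fst; simpl snd.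
  replace (INR n + 1 - d) with (INR n + (1 + x) / 2) by (unfold d; lra).
  apply Rsqr_incr_0_var; [rewrite Rsqr_sqrt | lra].
  - assert (E : y ^ 2 = d * (y ^ 2 / d)) by (field; lra).
    assert (d * (y ^ 2 / d) <= d * (2 * INR n + x + (1 + x) / 2))
      by (apply Rmult_le_compat_l; lra).
    assert (I : (INR n + (1 + x) / 2)² - ((x + INR n) ^ 2 + (y + 0) ^ 2)
      = d * (2 * INR n + x + (1 + x) / 2) - y ^ 2) by (unfold d, Rsqr; field).
    lra.
  - generalize (pow2_ge_0 (x + INR n)) (pow2_ge_0 (y + 0)); lra.
Qed.

Lemma binc_decrease v : Cre v < 1 -> exists N, forall n, (N <= n)%nat ->
  (1 - Cre v) / 2 * (Cnorm (binc v n) / INR (S n))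
  <= Cnorm (binc v n) - Cnorm (binc v (S n)).
Proof.
  intros Hv; destruct (Cnorm_shift_le v Hv) as [N HN]; exists N; intros n Hn.
  specialize (HN n Hn); set (d := (1 - Cre v) / 2) in *.
  assert (Hp : 0 < INR (S n)) by apply lt_0_INR, Nat.lt_0_succ.
  assert (E := Cnorm_binc_S v n).
  replace (Cnorm (binc v (S n))) with (Cnorm (v + RtoC (INR n))%Cx * Cnorm (binc v n) / INR (S n))
    by (rewrite <- E; field; lra).
  apply Rmult_le_reg_l with (1 := Hp).
  set (p := INR (S n)) in *; set (q := Cnorm (v + _)%Cx) in *; set (r := Cnorm (binc v n)) in *.
  replace (p * (d * (r / p))) with (d * r) by (field; lra).
  replace (p * (r - q * r / p)) with ((p - q) * r) by (field; lra).
  apply Rmult_le_compat_r; [apply Cnorm_ge0 | lra].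
Qed.

(** By [binc_decrease] the moduli do not increase from some [N] on, so the sum of the moduli up to
    [N] dominates them all. *)
Lemma binc_bounded v : Cre v < 1 -> exists M, forall n, Cnorm (binc v n) <= M.
Proof.
  intros Hv; destruct (binc_decrease v Hv) as [N HN].
  exists (sum_f_R0 (fun n => Cnorm (binc v n)) N); intros n.
  assert (P : forall k, 0 <= Cnorm (binc v k)) by (intros; apply Cnorm_ge0).
  destruct (Nat.le_gt_cases n N) as [H | H].
  - eapply Rle_trans; [apply (term_le_sum (fun n => Cnorm (binc v n))), P |].
    now apply sum_nonneg_mono.
  - eapply Rle_trans with (Cnorm (binc v N));
      [| apply (term_le_sum (fun n => Cnorm (binc v n))), P].
    apply Nat.lt_le_incl in H; induction H as [| m Hm IH]; [lra |].
    specialize (HN m Hm).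
    assert (0 <= (1 - Cre v) / 2 * (Cnorm (binc v m) / INR (S m))).
    { apply Rmult_le_pos; [lra |]; apply Rmult_le_pos; [apply P |].
      left; apply Rinv_0_lt_compat, lt_0_INR; lia. }
    lra.
Qed.

Lemma binc_summable v : Cre v < 1 ->
  exists K, forall N, sum_f_R0 (fun n => Cnorm (binc v n) / INR (S n)) N <= K.
Proof.
  intros Hv; destruct (binc_decrease v Hv) as [N HN].
  set (a := fun n => Cnorm (binc v n) / INR (S n)) in *.
  assert (P : forall k, 0 <= Cnorm (binc v k)) by (intros; apply Cnorm_ge0).
  assert (Q : forall k, 0 <= a k).
  { intros k; apply Rmult_le_pos; [apply P |].
    left; apply Rinv_0_lt_compat, lt_0_INR; lia. }
  set (d := (1 - Cre v) / 2) in *.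
  assert (Hd : 0 < d) by (unfold d; lra).
  (* Summing [binc_decrease] telescopes its right-hand side. *)
  assert (T : forall n, (N <= n)%nat ->
    sum_f_R0 a n <= sum_f_R0 a N + (Cnorm (binc v N) - Cnorm (binc v (S n))) / d + a N).
  { induction 1 as [| m Hm IH].
    - specialize (HN N (Nat.le_refl N)); specialize (Q N); fold (a N) in HN.
      assert (0 <= (Cnorm (binc v N) - Cnorm (binc v (S N))) / d).
      { apply Rmult_le_pos; [| left; now apply Rinv_0_lt_compat].
        assert (0 <= d * a N) by (apply Rmult_le_pos; lra). lra. }
      lra.
    - specialize (HN (S m) (le_S _ _ Hm)); fold (a (S m)) in HN.
      apply (Rmult_le_compat_r (/ d)) in HN; [| left; now apply Rinv_0_lt_compat].
      replace (d * a (S m) * / d) with (a (S m)) in HN by (field; lra).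
      simpl sum_f_R0; unfold Rdiv in *; lra. }
  exists (sum_f_R0 a N + Cnorm (binc v N) / d + a N); intros n.
  assert (B : forall m, 0 <= Cnorm (binc v m) / d).
  { intros m; apply Rmult_le_pos; [apply P | left; now apply Rinv_0_lt_compat]. }
  destruct (Nat.le_gt_cases n N) as [H | H].
  - assert (H1 := sum_nonneg_mono a n N Q H); specialize (B N); specialize (Q N); lra.
  - specialize (T n (Nat.lt_le_incl _ _ H)); specialize (B (S n)).
    unfold Rdiv in *; lra.
Qed.

(** * Complex series *)

Lemma Cpartial_eq u n :
  Cpartial u n = (sum_f_R0 (fun k => fst (u k)) n, sum_f_R0 (fun k => snd (u k)) n).
Proof.
  induction n as [|n IH]; simpl; [now destruct (u 0%nat) | now rewrite IH].
Qed.

Lemma Cnorm_Cpartial_le u (b : nat -> R) n :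
  (forall k, Cnorm (u k) <= b k) -> Cnorm (Cpartial u n) <= sum_f_R0 b n.
Proof.
  intros H; induction n as [|n IH]; simpl; [apply H |].
  eapply Rle_trans; [apply Cnorm_triangle |]; specialize (H (S n)); lra.
Qed.

Lemma Cpartial_ext u w n : (forall k, u k = w k) -> Cpartial u n = Cpartial w n.
Proof. intros H; induction n as [|n IH]; simpl; now rewrite ?IH, H. Qed.

Lemma Cpartial_add u w n :
  Cpartial (fun k => u k + w k)%Cx n = (Cpartial u n + Cpartial w n)%Cx.
Proof. induction n as [|n IH]; simpl; rewrite ?IH; ring. Qed.

Lemma Cpartial_scal z u n :
  Cpartial (fun k => z * u k)%Cx n = (z * Cpartial u n)%Cx.
Proof. induction n as [|n IH]; simpl; rewrite ?IH; ring. Qed.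

Lemma Cseries_cv_ext u w L : (forall k, u k = w k) -> Cseries_cv u L -> Cseries_cv w L.
Proof.
  intros H [H1 H2]; split; intros e He.
  - destruct (H1 e He) as [N HN]; exists N; intros n Hn.
    rewrite <- (Cpartial_ext u w n H); now apply HN.
  - destruct (H2 e He) as [N HN]; exists N; intros n Hn.
    rewrite <- (Cpartial_ext u w n H); now apply HN.
Qed.

Lemma Cseries_cv_add u w L M : Cseries_cv u L -> Cseries_cv w M ->
  Cseries_cv (fun k => u k + w k)%Cx (L + M)%Cx.
Proof.
  intros [H1 H2] [H3 H4]; split.
  - apply Un_cv_ext with (fun n => fst (Cpartial u n) + fst (Cpartial w n)).
    + intros n; now rewrite Cpartial_add.
    + now apply CV_plus.
  - apply Un_cv_ext with (fun n => snd (Cpartial u n) + snd (Cpartial w n)).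
    + intros n; now rewrite Cpartial_add.
    + now apply CV_plus.
Qed.

Lemma Un_cv_scal (k : R) a l : Un_cv a l -> Un_cv (fun n => k * a n) (k * l).
Proof. intros H; apply CV_mult; [| exact H]; intros e He; exists 0%nat; intros; now rewrite Rdist_eq. Qed.

Lemma Cseries_cv_scal z u L : Cseries_cv u L ->
  Cseries_cv (fun k => z * u k)%Cx (z * L)%Cx.
Proof.
  intros [H1 H2]; split.
  - apply Un_cv_ext with (fun n => fst z * fst (Cpartial u n) - snd z * snd (Cpartial u n)).
    + intros n; now rewrite Cpartial_scal.
    + apply CV_minus; now apply Un_cv_scal.
  - apply Un_cv_ext with (fun n => fst z * snd (Cpartial u n) + snd z * fst (Cpartial u n)).
    + intros n; now rewrite Cpartial_scal.
    + apply CV_plus; now apply Un_cv_scal.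
Qed.

Lemma Cseries_cv_Cnorm u L eps : Cseries_cv u L -> 0 < eps ->
  exists N, forall n, (N <= n)%nat -> Cnorm (Cpartial u n - L)%Cx < eps.
Proof.
  intros [H1 H2] He.
  destruct (H1 (eps / 2) ltac:(lra)) as [N1 HN1].
  destruct (H2 (eps / 2) ltac:(lra)) as [N2 HN2].
  exists (max N1 N2); intros n Hn.
  specialize (HN1 n ltac:(lia)); specialize (HN2 n ltac:(lia)).
  eapply Rle_lt_trans; [apply Cnorm_le_add |].
  unfold Rdist, Rminus in *; simpl; lra.
Qed.

Lemma bounded_sum_cv (b : nat -> R) K :
  (forall n, 0 <= b n) -> (forall n, sum_f_R0 b n <= K) ->
  exists l, Un_cv (sum_f_R0 b) l.
Proof.
  intros Hb HK; destruct (growing_cv (sum_f_R0 b)) as [l Hl].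
  - intros n; simpl; specialize (Hb (S n)); lra.
  - exists K; intros x [n ->]; apply HK.
  - now exists l.
Qed.

Lemma Cseries_cv_abs u (b : nat -> R) K :
  (forall n, Cnorm (u n) <= b n) -> (forall n, sum_f_R0 b n <= K) ->
  exists L, Cseries_cv u L.
Proof.
  intros Hu HK.
  assert (Hb : forall n, 0 <= b n)
    by (intros n; eapply Rle_trans; [apply Cnorm_ge0 | apply Hu]).
  destruct (bounded_sum_cv b K Hb HK) as [l Hl].
  assert (Eb : ex_series b) by (exists l; now apply is_series_Reals).
  assert (C : forall g : nat -> R, (forall n, Rabs (g n) <= b n) ->
    exists m, Un_cv (sum_f_R0 g) m).
  { intros g Hg.
    destruct (ex_series_le (K := R_AbsRing) (V := R_CompleteNormedModule) g b Hg Eb) as [m Hm].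
    exists m; now apply is_series_Reals. }
  destruct (C (fun n => fst (u n))) as [L1 H1];
    [intros n; eapply Rle_trans; [apply Rabs_fst_le | apply Hu] |].
  destruct (C (fun n => snd (u n))) as [L2 H2];
    [intros n; eapply Rle_trans; [apply Rabs_snd_le | apply Hu] |].
  exists (L1, L2); split.
  - eapply Un_cv_ext; [| exact H1]; intros n; now rewrite Cpartial_eq.
  - eapply Un_cv_ext; [| exact H2]; intros n; now rewrite Cpartial_eq.
Qed.

(** * The binomial series, uniformly on closed discs of radius less than 1 *)

Lemma is_Cderive_pown f t l n : is_Cderive f t l ->
  is_Cderive (fun x => Cpown (f x) (S n)) t
    (RtoC (INR (S n)) * Cpown (f t) n * l)%Cx.
Proof.
  intros Hf; induction n as [|n IH].
  - eapply is_Cderive_eq; [exact (is_Cderive_mul _ _ _ _ _ (is_Cderive_const (RtoC 1) t) Hf) |].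
    simpl; ring.
  - eapply is_Cderive_eq; [exact (is_Cderive_mul _ _ _ _ _ IH Hf) |].
    rewrite (RtoC_S (S n)); simpl Cpown; ring.
Qed.

Lemma is_Cderive_linear k t : is_Cderive (fun x => k * RtoC x)%Cx t k.
Proof.
  eapply is_Cderive_eq;
    [exact (is_Cderive_mul _ _ _ _ _ (is_Cderive_const k t) (is_Cderive_RtoC t)) | cbv beta; ring].
Qed.

Definition binom_sum (v z : Cpx) (N : nat) : Cpx :=
  Cpartial (fun n => binc v n * Cpown z n)%Cx N.

Lemma binom_sum_0 v N : binom_sum v (RtoC 0) N = RtoC 1.
Proof.
  unfold binom_sum; induction N as [|N IH]; simpl; [rewrite binc_0 | rewrite IH]; ring.
Qed.

(* The binomial series solves [(1 - z) y' = v y]; its partial sums solve it up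
   to one top-degree term. *)
Lemma is_Cderive_binom_sum v q t N : (RtoC 1 - q * RtoC t)%Cx <> RtoC 0 ->
  is_Cderive (fun x => binom_sum v (q * RtoC x)%Cx N) t
    ((v * q * binom_sum v (q * RtoC t) N
      - (v + RtoC (INR N)) * binc v N * (q * Cpown (q * RtoC t) N))
     / (RtoC 1 - q * RtoC t))%Cx.
Proof.
  intros Hz; unfold binom_sum; induction N as [|N IH]; simpl Cpartial.
  - eapply is_Cderive_eq; [apply (is_Cderive_const (binc v 0 * RtoC 1)%Cx) |].
    simpl Cpown; change (INR 0) with 0; field; exact Hz.
  - eapply is_Cderive_eq.
    { exact (is_Cderive_add _ _ _ _ _ IH
        (is_Cderive_mul _ _ _ _ _ (is_Cderive_const (binc v (S N)) t)
          (is_Cderive_pown _ _ _ N (is_Cderive_linear q t)))). }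
    assert (E := binc_S v N); rewrite RtoC_S in *.
    change (Cpown (q * RtoC t)%Cx (S N)) with (Cpown (q * RtoC t) N * (q * RtoC t))%Cx.
    set (z := (q * RtoC t)%Cx) in *; set (s := Cpartial _ N).
    set (p := Cpown z N) in *.
    replace (RtoC 0 * (p * z) + binc v (S N) * ((RtoC (INR N) + RtoC 1) * p * q))%Cx
      with ((RtoC (INR N) + RtoC 1) * binc v (S N) * (p * q))%Cx by ring.
    replace ((v * q * (s + binc v (S N) * (p * z)) -
       (v + (RtoC (INR N) + RtoC 1)) * binc v (S N) * (q * (p * z))))%Cx
      with (v * q * s - (RtoC (INR N) + RtoC 1) * binc v (S N) * (q * (p * z)))%Cx by ring.
    (* By [binc_S] the old defect and the derivative of the new term carry the same coefficient, and
       [1 - (1 - z) = z] moves the defect up by one degree. *)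
    rewrite E; field; exact Hz.
Qed.

Lemma fst_one_sub z rho : Cnorm z <= rho -> 1 - rho <= fst (RtoC 1 - z)%Cx.
Proof.
  intros H; assert (H' := Rabs_fst_le z); assert (H'' := Rle_abs (fst z)); simpl; lra.
Qed.

(** The modulus of [(1 - z)^v] is the exponential of [Re v ln|1 - z| - Im v arg(1 - z)], with
    [1 - rho <= |1 - z| <= 2] and an argument of size at most [PI / 2]. It will serve for both [v]
    and [-v]. *)
Lemma Cexp_log_bounded v rho : 0 <= rho < 1 ->
  exists K, 0 < K /\ forall z, Cnorm z <= rho ->
    Cnorm (Cexp (v * Clog_rhp (RtoC 1 - z))%Cx) <= K.
Proof.
  intros Hr.
  (* As [ln (1 - rho) <= 0 <= ln 2], the length of this range bounds the absolute value of
     [ln|1 - z|]. *)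
  exists (exp (Rabs (fst v) * (ln 2 - ln (1 - rho)) + Rabs (snd v) * (PI / 2))).
  split; [apply exp_pos |]; intros z Hz.
  rewrite Cnorm_exp.
  assert (Hf := fst_one_sub z rho Hz).
  assert (H1 : 1 - rho <= Cnorm (RtoC 1 - z)%Cx).
  { eapply Rle_trans; [exact Hf |]; eapply Rle_trans; [apply Rle_abs | apply Rabs_fst_le]. }
  assert (H2 : Cnorm (RtoC 1 - z)%Cx <= 2).
  { eapply Rle_trans; [apply Cnorm_triangle |].
    rewrite Cnorm_opp, Cnorm_RtoC, Rabs_R1; lra. }
  assert (L1 : ln (1 - rho) <= ln (Cnorm (RtoC 1 - z)%Cx)) by (apply ln_le; lra).
  assert (L2 : ln (Cnorm (RtoC 1 - z)%Cx) <= ln 2) by (apply ln_le; lra).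
  assert (L3 : ln (1 - rho) <= 0) by (rewrite <- ln_1; apply ln_le; lra).
  assert (L4 : 0 <= ln 2) by (rewrite <- ln_1; apply ln_le; lra).
  assert (Ha : Rabs (ln (Cnorm (RtoC 1 - z)%Cx)) <= ln 2 - ln (1 - rho)) by (apply Rabs_le; lra).
  assert (Hb : Rabs (atan (snd (RtoC 1 - z)%Cx / fst (RtoC 1 - z)%Cx)) <= PI / 2).
  { destruct (atan_bound (snd (RtoC 1 - z)%Cx / fst (RtoC 1 - z)%Cx)); apply Rabs_le; lra. }
  assert (E : fst (v * Clog_rhp (RtoC 1 - z))%Cx <=
    Rabs (fst v) * (ln 2 - ln (1 - rho)) + Rabs (snd v) * (PI / 2)).
  { unfold Clog_rhp; simpl fst at 1.
    set (x := ln _) in *; set (y := atan _) in *.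
    eapply Rle_trans; [apply Rle_abs |].
    eapply Rle_trans; [apply Rabs_triang |].
    rewrite Rabs_Ropp, !Rabs_mult.
    apply Rplus_le_compat; apply Rmult_le_compat_l; auto using Rabs_pos. }
  destruct E as [E | E]; [left; now apply exp_increasing | right; now rewrite E].
Qed.

(** The power [x^n] is the least of [1, x, ..., x^n], and
    [(1 - x)(1 + x + ... + x^n) = 1 - x^(n+1)]. The induction needs the term [x^(n+1)] kept on the
    left. *)
Lemma succ_mul_pow_le x n : 0 <= x <= 1 -> (1 - x) * (INR (S n) * x ^ n) <= 1.
Proof.
  intros Hx.
  assert (H : (1 - x) * (INR (S n) * x ^ n) + x ^ S n <= 1).
  { induction n as [|n IH]; [simpl; lra |].
    rewrite (S_INR (S n)).
    replace ((1 - x) * ((INR (S n) + 1) * x ^ S n) + x ^ S (S n)) with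
      (x * ((1 - x) * (INR (S n) * x ^ n) + x ^ S n) + (1 - x) * x ^ S n)
      by (rewrite <- !tech_pow_Rmult; ring).
    assert (0 <= x ^ S n <= 1).
    { split; [now apply pow_le |]; rewrite <- (pow1 (S n)); now apply pow_incr. }
    apply Rle_trans with (x * 1 + (1 - x) * 1); [| lra].
    apply Rplus_le_compat; apply Rmult_le_compat_l; lra. }
  assert (0 <= x ^ S n) by now apply pow_le.
  lra.
Qed.

Lemma succ_mul_pow_lim rho eps : 0 <= rho < 1 -> 0 < eps ->
  exists N0, forall N, (N0 <= N)%nat -> INR (S N) * rho ^ N < eps.
Proof.
  (* With [r] strictly between [rho] and 1, [rho^N = x^N r^N]: the factor [x^N] keeps [N + 1]
     bounded and [r^N] tends to 0. *)
  intros Hr He; set (r := (1 + rho) / 2); set (x := rho / r).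
  assert (Hr' : 0 < r < 1) by (unfold r; lra).
  assert (Hx : 0 <= x < 1).
  { unfold x; split; [apply Rmult_le_pos; [lra | left; now apply Rinv_0_lt_compat] |].
    apply Rmult_lt_reg_r with r; [lra |]; unfold r, Rdiv in *; field_simplify; lra. }
  destruct (pow_lt_1_zero r ltac:(rewrite Rabs_pos_eq; lra) (eps * (1 - x)) ltac:(nra))
    as [N0 HN]; exists N0; intros N H; specialize (HN N H).
  assert (B := succ_mul_pow_le x N ltac:(lra)).
  assert (0 < r ^ N) by now apply pow_lt.
  rewrite Rabs_pos_eq in HN by lra.
  replace (rho ^ N) with (x ^ N * r ^ N)
    by (rewrite <- Rpow_mult_distr; f_equal; unfold x; field; lra).
  apply Rmult_lt_reg_l with (1 - x); [lra |].
  apply Rle_lt_trans with (1 * r ^ N); [| lra].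
  rewrite <- !Rmult_assoc in *; apply Rmult_le_compat_r; lra.
Qed.

(** Along the segment from 0 to [q], the product [phi] of [(1 - qt)^v] with the partial sum would be
    constantly 1 for the full series. Here its derivative is the top-degree defect alone, so
    [phi 1 - 1] is small; multiplying by [(1 - q)^(-v)] gives the remainder. *)
Lemma binom_remainder_bound v rho : Cre v < 1 -> 0 <= rho < 1 ->
  exists K, 0 < K /\ forall q N, Cnorm q <= rho ->
  Cnorm (Cexp (- v * Clog_rhp (RtoC 1 - q)) - binom_sum v q N)%Cx
  <= K * (INR (S N) * rho ^ N).
Proof.
  intros Hv Hr.
  destruct (Cexp_log_bounded v rho Hr) as [K1 [HK1 B1]].
  destruct (Cexp_log_bounded (- v)%Cx rho Hr) as [K2 [HK2 B2]].
  destruct (binc_bounded v Hv) as [M HM].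
  assert (HM0 : 0 <= M) by (eapply Rle_trans; [apply Cnorm_ge0 | apply (HM 0%nat)]).
  (* [K2] bounds [(1 - q)^(-v)], 2 comes from [Cderive_increment], [K1 / (1 - rho)] bounds
     [(1 - qt)^v / (1 - qt)], and [M + 1] is a visibly positive bound for the coefficient. *)
  exists (K2 * (2 * (K1 / (1 - rho) * (M + 1)))); split.
  { repeat apply Rmult_lt_0_compat; try lra; apply Rinv_0_lt_compat; lra. }
  intros q N Hq.
  set (phi := fun t => (Cexp (v * Clog_rhp (RtoC 1 - q * RtoC t))
    * binom_sum v (q * RtoC t) N)%Cx).
  set (phi' := fun t => (- (Cexp (v * Clog_rhp (RtoC 1 - q * RtoC t)) / (RtoC 1 - q * RtoC t)
    * ((v + RtoC (INR N)) * binc v N * (q * Cpown (q * RtoC t) N))))%Cx).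
  assert (Hqt : forall t, 0 <= t <= 1 -> Cnorm (q * RtoC t)%Cx <= rho).
  { intros t Ht; rewrite Cnorm_mul, Cnorm_RtoC, Rabs_pos_eq by lra.
    assert (P := Cnorm_ge0 q); nra. }
  assert (Hp : forall t, 0 <= t <= 1 -> 1 - rho <= fst (RtoC 1 - q * RtoC t)%Cx)
    by (intros t Ht; now apply fst_one_sub, Hqt).
  assert (D : Cnorm (phi 1 - phi 0)%Cx <= 2 * (K1 / (1 - rho) * ((M + 1) * (INR (S N) * rho ^ N)))).
  { apply Cderive_increment with phi'; intros t Ht; specialize (Hp t Ht); specialize (Hqt t Ht).
    - assert (Hz : (RtoC 1 - q * RtoC t)%Cx <> RtoC 0) by (apply fst_neq0; lra).
      eapply is_Cderive_eq.
      + apply is_Cderive_mul; [| now apply is_Cderive_binom_sum].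
        apply is_Cderive_exp, is_Cderive_mul; [apply is_Cderive_const |].
        apply is_Cderive_log; [lra |].
        apply is_Cderive_sub; [apply is_Cderive_const | apply is_Cderive_linear].
      + unfold phi'; field; exact Hz.
    - unfold phi'; rewrite Cnorm_opp, !Cnorm_mul, Cnorm_div, Cnorm_pown by (apply fst_neq0; lra).
      (* Turns [|v + N| |A_N|] into [(N + 1) |A_(N+1)|], the source of the factor [INR (S N)]. *)
      rewrite <- Cnorm_binc_S.
      assert (H1 : 1 - rho <= Cnorm (RtoC 1 - q * RtoC t)%Cx).
      { eapply Rle_trans; [exact Hp |]; eapply Rle_trans; [apply Rle_abs | apply Rabs_fst_le]. }
      apply Rmult_le_compat.
      + apply Rmult_le_pos; [apply Cnorm_ge0 | left; apply Rinv_0_lt_compat; lra].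
      + repeat apply Rmult_le_pos; try apply Cnorm_ge0; [apply pos_INR | apply pow_le, Cnorm_ge0].
      + apply Rmult_le_compat; [apply Cnorm_ge0 | left; apply Rinv_0_lt_compat; lra | now apply B1 |].
        apply Rinv_le_contravar; lra.
      + specialize (HM (S N)); assert (P := pos_INR (S N)).
        assert (P1 := Cnorm_ge0 q); assert (P2 := Cnorm_ge0 (binc v (S N))).
        assert (P3 : 0 <= Cnorm (q * RtoC t)%Cx ^ N <= rho ^ N)
          by (split; [apply pow_le, Cnorm_ge0 | apply pow_incr; split; [apply Cnorm_ge0 | exact Hqt]]).
        replace ((M + 1) * (INR (S N) * rho ^ N)) with (INR (S N) * (M + 1) * (1 * rho ^ N)) by ring.
        apply Rmult_le_compat; [now apply Rmult_le_pos | | |].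
        * now apply Rmult_le_pos.
        * apply Rmult_le_compat_l; lra.
        * apply Rmult_le_compat; lra. }
  assert (E0 : phi 0 = RtoC 1).
  { unfold phi.
    replace (q * RtoC 0)%Cx with (RtoC 0) by (apply Cpx_eq; simpl; ring).
    replace (RtoC 1 - RtoC 0)%Cx with (RtoC 1) by ring.
    replace (Clog_rhp (RtoC 1)) with (RtoC 0).
    - replace (v * RtoC 0)%Cx with (RtoC 0) by ring; rewrite Cexp_0.
      rewrite binom_sum_0; ring.
    - unfold Clog_rhp; rewrite Cnorm_RtoC, Rabs_R1, ln_1; simpl.
      replace (0 / 1) with 0 by field; now rewrite atan_0. }
  assert (E1 : (Cexp (- v * Clog_rhp (RtoC 1 - q)) - binom_sum v q N)%Cx
    = (- (Cexp (- v * Clog_rhp (RtoC 1 - q)) * (phi 1 - phi 0)))%Cx).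
  { rewrite E0; unfold phi; replace (q * RtoC 1)%Cx with q by ring.
    replace (- v * Clog_rhp (RtoC 1 - q))%Cx with (- (v * Clog_rhp (RtoC 1 - q)))%Cx by ring.
    rewrite Cexp_opp; field; apply Cexp_neq0. }
  rewrite E1, Cnorm_opp, Cnorm_mul.
  replace (K2 * (2 * (K1 / (1 - rho) * (M + 1))) * (INR (S N) * rho ^ N))
    with (K2 * (2 * (K1 / (1 - rho) * ((M + 1) * (INR (S N) * rho ^ N))))) by ring.
  apply Rmult_le_compat; try apply Cnorm_ge0; [now apply B2 | exact D].
Qed.

Lemma binom_series_uniform v rho eps : Cre v < 1 -> 0 <= rho < 1 -> 0 < eps ->
  exists N0, forall N q, (N0 <= N)%nat -> Cnorm q <= rho ->
  Cnorm (Cexp (- v * Clog_rhp (RtoC 1 - q)) - binom_sum v q N)%Cx < eps.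
Proof.
  intros Hv Hr He.
  destruct (binom_remainder_bound v rho Hv Hr) as [K [HK B]].
  destruct (succ_mul_pow_lim rho (eps / K) Hr ltac:(now apply Rdiv_lt_0_compat)) as [N0 HN].
  exists N0; intros N q H Hq.
  eapply Rle_lt_trans; [apply (B q N Hq) |].
  specialize (HN N H); apply (Rmult_lt_compat_l K) in HN; [| exact HK].
  replace (K * (eps / K)) with eps in HN by (field; lra); exact HN.
Qed.

(** * Integrals of complex functions over compact intervals *)

Definition is_CRInt (f : R -> Cpx) (u w : R) (I : Cpx) : Prop :=
  is_RInt (fun x => fst (f x)) u w (fst I) /\
  is_RInt (fun x => snd (f x)) u w (snd I).

Lemma is_CRInt_eq f u w I J : is_CRInt f u w I -> I = J -> is_CRInt f u w J.
Proof. intros H <-; exact H. Qed.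

Lemma is_CRInt_ext f g u w I : u <= w -> (forall x, u < x < w -> f x = g x) ->
  is_CRInt f u w I -> is_CRInt g u w I.
Proof.
  intros Huw H [H1 H2]; split.
  - eapply is_RInt_ext; [| exact H1]; intros x Hx.
    rewrite Rmin_left, Rmax_right in Hx by exact Huw; simpl; now rewrite H.
  - eapply is_RInt_ext; [| exact H2]; intros x Hx.
    rewrite Rmin_left, Rmax_right in Hx by exact Huw; simpl; now rewrite H.
Qed.

Lemma is_CRInt_add f g u w I J : is_CRInt f u w I -> is_CRInt g u w J ->
  is_CRInt (fun x => f x + g x)%Cx u w (I + J)%Cx.
Proof.
  intros [H1 H2] [H3 H4]; split.
  - exact (is_RInt_plus (V := R_NormedModule) _ _ _ _ _ _ H1 H3).
  - exact (is_RInt_plus (V := R_NormedModule) _ _ _ _ _ _ H2 H4).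
Qed.

Lemma is_CRInt_scal z f u w I : is_CRInt f u w I ->
  is_CRInt (fun x => z * f x)%Cx u w (z * I)%Cx.
Proof.
  intros [H1 H2]; split.
  - exact (is_RInt_minus (V := R_NormedModule) _ _ _ _ _ _
      (is_RInt_scal (V := R_NormedModule) _ _ _ (fst z) _ H1)
      (is_RInt_scal (V := R_NormedModule) _ _ _ (snd z) _ H2)).
  - exact (is_RInt_plus (V := R_NormedModule) _ _ _ _ _ _
      (is_RInt_scal (V := R_NormedModule) _ _ _ (fst z) _ H2)
      (is_RInt_scal (V := R_NormedModule) _ _ _ (snd z) _ H1)).
Qed.

Lemma is_CRInt_sub f g u w I J : is_CRInt f u w I -> is_CRInt g u w J ->
  is_CRInt (fun x => f x - g x)%Cx u w (I - J)%Cx.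
Proof.
  intros [H1 H2] [H3 H4]; split.
  - exact (is_RInt_minus (V := R_NormedModule) _ _ _ _ _ _ H1 H3).
  - exact (is_RInt_minus (V := R_NormedModule) _ _ _ _ _ _ H2 H4).
Qed.

Lemma is_CRInt_Cpartial (g : nat -> R -> Cpx) u w J N :
  (forall n, is_CRInt (g n) u w (J n)) ->
  is_CRInt (fun x => Cpartial (fun n => g n x) N) u w (Cpartial J N).
Proof.
  intros H; induction N as [|N IH]; [apply H |].
  simpl; now apply is_CRInt_add.
Qed.

Lemma Cnorm_is_CRInt_le f u w I e : u <= w -> is_CRInt f u w I ->
  (forall x, u <= x <= w -> Cnorm (f x) <= e) -> Cnorm I <= 2 * ((w - u) * e).
Proof.
  intros Huw [H1 H2] He.
  assert (B1 := norm_RInt_le_const (V := R_NormedModule) _ u w (fst I) e Huw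
    (fun x Hx => Rle_trans _ _ _ (Rabs_fst_le (f x)) (He x Hx)) H1).
  assert (B2 := norm_RInt_le_const (V := R_NormedModule) _ u w (snd I) e Huw
    (fun x Hx => Rle_trans _ _ _ (Rabs_snd_le (f x)) (He x Hx)) H2).
  eapply Rle_trans; [apply Cnorm_le_add |].
  change norm with Rabs in *; unfold norm in B1, B2; simpl in B1, B2.
  unfold abs in B1, B2; simpl in B1, B2; lra.
Qed.

Lemma ex_CRInt f f' u w : u <= w ->
  (forall x, u <= x <= w -> is_Cderive f x (f' x)) -> exists I, is_CRInt f u w I.
Proof.
  intros Huw H.
  assert (E : forall g g' : R -> R, (forall x, u <= x <= w -> is_derive g x (g' x)) ->
    ex_RInt g u w).
  { intros g g' Hg; apply (ex_RInt_continuous (V := R_CompleteNormedModule)).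
    intros x Hx; rewrite Rmin_left, Rmax_right in Hx by exact Huw.
    apply (ex_derive_continuous g); exists (g' x); now apply Hg. }
  destruct (E (fun x => fst (f x)) (fun x => fst (f' x))) as [I1 H1];
    [intros x Hx; now apply H |].
  destruct (E (fun x => snd (f x)) (fun x => snd (f' x))) as [I2 H2];
    [intros x Hx; now apply H |].
  now exists (I1, I2).
Qed.

Lemma is_CRInt_derive F f f' u w : u <= w ->
  (forall x, u <= x <= w -> is_Cderive F x (f x)) ->
  (forall x, u <= x <= w -> is_Cderive f x (f' x)) ->
  is_CRInt f u w (F w - F u)%Cx.
Proof.
  intros Huw H H'; split.
  - apply (is_RInt_derive (V := R_CompleteNormedModule) (fun x => fst (F x)));
      intros x Hx; rewrite Rmin_left, Rmax_right in Hx by exact Huw.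
    + now apply H.
    + apply (ex_derive_continuous (fun x => fst (f x))).
      exists (fst (f' x)); now apply H'.
  - apply (is_RInt_derive (V := R_CompleteNormedModule) (fun x => snd (F x)));
      intros x Hx; rewrite Rmin_left, Rmax_right in Hx by exact Huw.
    + now apply H.
    + apply (ex_derive_continuous (fun x => snd (f x))).
      exists (snd (f' x)); now apply H'.
Qed.

Lemma is_Cderive_Cexp_linear mu x :
  is_Cderive (fun x => Cexp (mu * RtoC x))%Cx x (mu * Cexp (mu * RtoC x))%Cx.
Proof. apply is_Cderive_exp, is_Cderive_linear. Qed.

Lemma is_CRInt_Cexp mu u w : u <= w -> mu <> RtoC 0 ->
  is_CRInt (fun x => Cexp (- mu * RtoC x))%Cx u w
    ((Cexp (- mu * RtoC u) - Cexp (- mu * RtoC w)) / mu)%Cx.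
Proof.
  intros Huw Hmu.
  eapply is_CRInt_eq.
  - apply (is_CRInt_derive (fun x => (- (RtoC 1 / mu)) * Cexp (- mu * RtoC x))%Cx)
      with (f' := fun x => (- mu * Cexp (- mu * RtoC x))%Cx); [exact Huw | |];
      intros x _.
    + eapply is_Cderive_eq;
        [exact (is_Cderive_mul _ _ _ _ _ (is_Cderive_const _ x) (is_Cderive_Cexp_linear (- mu)%Cx x)) |].
      cbv beta; field; exact Hmu.
    + apply is_Cderive_Cexp_linear.
  - cbv beta; field; exact Hmu.
Qed.

(** * Improper integrals over the half-line *)

(** A relational version of [improper_int_0_inf]: sums and multiples can be formed without carrying
    integrability proofs inside the integrals. *)
Definition improper_CRInt (f : R -> Cpx) (L : Cpx) : Prop :=
  forall eps, 0 < eps -> exists d M, 0 < d /\ 0 < M /\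
  forall u w, 0 < u -> u < d -> M < w -> u < w ->
  exists I, is_CRInt f u w I /\ Cnorm (I - L)%Cx < eps.

Lemma improper_CRInt_ext f g L : (forall x, 0 < x -> f x = g x) ->
  improper_CRInt f L -> improper_CRInt g L.
Proof.
  intros H HL eps He; destruct (HL eps He) as (d & M & Hd & HM & B).
  exists d, M; repeat split; try assumption; intros u w Hu Hud HMw Huw.
  destruct (B u w Hu Hud HMw Huw) as (I & HI & HIL).
  exists I; split; [| exact HIL].
  apply (is_CRInt_ext f); [lra | | exact HI]; intros x Hx; apply H; lra.
Qed.

Lemma improper_CRInt_add f g L J : improper_CRInt f L -> improper_CRInt g J ->
  improper_CRInt (fun x => f x + g x)%Cx (L + J)%Cx.
Proof.
  intros H1 H2 eps He.
  destruct (H1 (eps / 2) ltac:(lra)) as (d1 & M1 & Hd1 & HM1 & B1).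
  destruct (H2 (eps / 2) ltac:(lra)) as (d2 & M2 & Hd2 & HM2 & B2).
  exists (Rmin d1 d2), (Rmax M1 M2).
  split; [now apply Rmin_glb_lt |].
  split; [eapply Rlt_le_trans; [exact HM1 | apply Rmax_l] |].
  intros u w Hu Hud HMw Huw.
  assert (X1 := Rmin_l d1 d2); assert (X2 := Rmin_r d1 d2).
  assert (X3 := Rmax_l M1 M2); assert (X4 := Rmax_r M1 M2).
  destruct (B1 u w) as (I1 & HI1 & N1); try lra.
  destruct (B2 u w) as (I2 & HI2 & N2); try lra.
  exists (I1 + I2)%Cx; split; [now apply is_CRInt_add |].
  replace (I1 + I2 - (L + J))%Cx with ((I1 - L) + (I2 - J))%Cx by ring.
  eapply Rle_lt_trans; [apply Cnorm_triangle | lra].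
Qed.

Lemma improper_CRInt_scal z f L : improper_CRInt f L ->
  improper_CRInt (fun x => z * f x)%Cx (z * L)%Cx.
Proof.
  intros H eps He.
  assert (Hz := Cnorm_ge0 z).
  destruct (H (eps / (Cnorm z + 1))) as (d & M & Hd & HM & B);
    [apply Rdiv_lt_0_compat; lra |].
  exists d, M; repeat split; try assumption; intros u w Hu Hud HMw Huw.
  destruct (B u w Hu Hud HMw Huw) as (I & HI & N).
  exists (z * I)%Cx; split; [now apply is_CRInt_scal |].
  replace (z * I - z * L)%Cx with (z * (I - L))%Cx by ring.
  rewrite Cnorm_mul; apply Rle_lt_trans with ((Cnorm z + 1) * Cnorm (I - L)%Cx).
  - apply Rmult_le_compat_r; [apply Cnorm_ge0 | lra].
  - apply (Rmult_lt_compat_l (Cnorm z + 1)) in N; [| lra].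
    replace ((Cnorm z + 1) * (eps / (Cnorm z + 1))) with eps in N by (field; lra).
    exact N.
Qed.

Lemma improper_CRInt_int_0_inf f L : improper_CRInt f L -> improper_int_0_inf f L.
Proof.
  intros H eps He; destruct (H eps He) as (d & M & Hd & HM & B).
  exists d, M; repeat split; try assumption; intros u w Hu Hud HMw Huw.
  destruct (B u w Hu Hud HMw Huw) as (I & [H1 H2] & N).
  exists (ex_RInt_Reals_0 _ _ _ (ex_intro _ _ H1)),
    (ex_RInt_Reals_0 _ _ _ (ex_intro _ _ H2)).
  rewrite <- !RInt_Reals.
  rewrite (is_RInt_unique (V := R_CompleteNormedModule) _ _ _ _ H1).
  rewrite (is_RInt_unique (V := R_CompleteNormedModule) _ _ _ _ H2).
  now destruct I.
Qed.

(** * Termwise integration of one exponential times the binomial power *)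

Lemma Cnorm_Cexp_le_1 (z : Cpx) : fst z <= 0 -> Cnorm (Cexp z) <= 1.
Proof.
  intros H; rewrite Cnorm_exp, <- exp_0.
  destruct H as [H | ->]; [left; now apply exp_increasing | right; reflexivity].
Qed.

(** The path [t -> e^(zt)] stays in the closed unit disc, so its speed is at most [|z|]. *)
Lemma Cnorm_one_sub_Cexp_le (z : Cpx) : fst z <= 0 -> Cnorm (Cexp z - RtoC 1)%Cx <= 2 * Cnorm z.
Proof.
  intros Hz.
  assert (H := Cderive_increment (fun t => Cexp (z * RtoC t))%Cx
    (fun t => z * Cexp (z * RtoC t))%Cx (Cnorm z)).
  cbv beta in H.
  replace (z * RtoC 1)%Cx with z in H by ring.
  replace (z * RtoC 0)%Cx with (RtoC 0) in H by ring.
  rewrite Cexp_0 in H; apply H; intros t Ht; [apply is_Cderive_Cexp_linear |].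
  rewrite Cnorm_mul; assert (P := Cnorm_ge0 z).
  assert (Cnorm (Cexp (z * RtoC t))%Cx <= 1) by (apply Cnorm_Cexp_le_1; simpl; nra).
  nra.
Qed.

Definition exp_binom (v c mu : Cpx) (x : R) : Cpx :=
  (Cexp (- mu * RtoC x)
   * Cexp (- v * Clog_rhp (RtoC 1 - Cexp (RtoC (-2) * (c * RtoC x)))))%Cx.

Lemma Cnorm_exp_m2 c x : Cnorm (Cexp (RtoC (-2) * (c * RtoC x)))%Cx = exp (- 2 * (Cre c * x)).
Proof. rewrite Cnorm_exp; f_equal; unfold Cre; simpl; ring. Qed.

Lemma Cnorm_exp_m2_lt1 c x : 0 < Cre c -> 0 < x ->
  Cnorm (Cexp (RtoC (-2) * (c * RtoC x)))%Cx < 1.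
Proof.
  intros Hc Hx; rewrite Cnorm_exp_m2, <- exp_0; apply exp_increasing; nra.
Qed.

Lemma fst_one_sub_exp_pos c x : 0 < Cre c -> 0 < x ->
  0 < fst (RtoC 1 - Cexp (RtoC (-2) * (c * RtoC x)))%Cx.
Proof.
  intros Hc Hx; eapply Rlt_le_trans; [| apply fst_one_sub, Rle_refl].
  generalize (Cnorm_exp_m2_lt1 c x Hc Hx); lra.
Qed.

(** Needed for continuity on [[u, w]] only, so the derivative is left for unification to find. *)
Lemma ex_derive_exp_binom v c mu : 0 < Cre c ->
  exists f', forall x, 0 < x -> is_Cderive (exp_binom v c mu) x (f' x).
Proof.
  intros Hc; eexists; intros x Hx; unfold exp_binom.
  apply is_Cderive_mul; [apply is_Cderive_Cexp_linear |].
  apply is_Cderive_exp, is_Cderive_mul; [apply is_Cderive_const |].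
  apply (is_Cderive_log (fun x => RtoC 1 - Cexp (RtoC (-2) * (c * RtoC x)))%Cx);
    [now apply fst_one_sub_exp_pos |].
  apply is_Cderive_sub; [apply is_Cderive_const |].
  apply is_Cderive_exp, is_Cderive_mul; [apply is_Cderive_const | apply is_Cderive_linear].
Qed.

Lemma exp_binom_sum_eq v c mu N x :
  (Cexp (- mu * RtoC x) * binom_sum v (Cexp (RtoC (-2) * (c * RtoC x))) N)%Cx =
  Cpartial (fun n => binc v n *
    Cexp (- (mu + RtoC 2 * RtoC (INR n) * c) * RtoC x))%Cx N.
Proof.
  unfold binom_sum; rewrite <- Cpartial_scal; apply Cpartial_ext; intros n.
  rewrite <- Cexp_mul_nat.
  replace (- (mu + RtoC 2 * RtoC (INR n) * c) * RtoC x)%Cx with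
    (- mu * RtoC x + RtoC (INR n) * (RtoC (-2) * (c * RtoC x)))%Cx
    by (apply Cpx_eq; simpl; ring).
  rewrite Cexp_add; ring.
Qed.

Lemma fst_exponent_ge c mu n : 0 < Cre c -> 0 < Cre mu ->
  Rmin (Cre mu) (2 * Cre c) * INR (S n) <= fst (mu + RtoC 2 * RtoC (INR n) * c)%Cx.
Proof.
  intros Hc Hmu; rewrite S_INR.
  assert (M1 := Rmin_l (Cre mu) (2 * Cre c)); assert (M2 := Rmin_r (Cre mu) (2 * Cre c)).
  assert (P := pos_INR n); unfold Cre in *; simpl.
  set (m := Rmin _ _) in *; nra.
Qed.

(** On [[u, w]] the argument [q = e^(-2cx)] stays in the disc of radius [e^(-2 Re(c) u) < 1], where
    the binomial series is uniform; the factor [e^(-mu x)] has modulus at most 1. *)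
Lemma exp_binom_RInt v c mu u w I eps : Cre v < 1 -> 0 < Cre c -> 0 < Cre mu ->
  0 < u < w -> is_CRInt (exp_binom v c mu) u w I -> 0 < eps ->
  exists N0, forall N, (N0 <= N)%nat ->
  Cnorm (I - Cpartial (fun n => binc v n *
    ((Cexp (- (mu + RtoC 2 * RtoC (INR n) * c) * RtoC u)
      - Cexp (- (mu + RtoC 2 * RtoC (INR n) * c) * RtoC w))
     / (mu + RtoC 2 * RtoC (INR n) * c))) N)%Cx <= eps.
Proof.
  intros Hv Hc Hmu Huw HI He.
  set (rho := exp (- 2 * (Cre c * u))).
  assert (Hr : 0 <= rho < 1).
  { split; [left; apply exp_pos |]; unfold rho; rewrite <- exp_0; apply exp_increasing; nra. }
  destruct (binom_series_uniform v rho (eps / (2 * (w - u))) Hv Hr) as [N0 HN];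
    [apply Rdiv_lt_0_compat; lra |].
  exists N0; intros N H.
  replace eps with (2 * ((w - u) * (eps / (2 * (w - u))))) by (field; lra).
  eapply Cnorm_is_CRInt_le; [| apply is_CRInt_sub; [exact HI |] |]; [lra | |].
  - apply is_CRInt_Cpartial with (g := fun n x => (binc v n *
      Cexp (- (mu + RtoC 2 * RtoC (INR n) * c) * RtoC x))%Cx).
    intros n; apply is_CRInt_scal, is_CRInt_Cexp; [lra |].
    apply fst_neq0; eapply Rlt_le_trans; [| now apply fst_exponent_ge].
    apply Rmult_lt_0_compat; [apply Rmin_glb_lt; lra | apply lt_0_INR; lia].
  - intros x Hx; cbv beta; rewrite <- exp_binom_sum_eq; unfold exp_binom.
    set (q := Cexp (RtoC (-2) * (c * RtoC x))%Cx).
    assert (Hq : Cnorm q <= rho).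
    { unfold q, rho; rewrite Cnorm_exp_m2.
      assert (E : -2 * (Cre c * x) <= -2 * (Cre c * u)) by nra.
      destruct E as [E | E]; [left; now apply exp_increasing | right; now rewrite E]. }
    specialize (HN N q H Hq).
    match goal with |- Cnorm (?e * ?a - ?e * ?b)%Cx <= _ =>
      replace (e * a - e * b)%Cx with (e * (a - b))%Cx by ring end.
    rewrite Cnorm_mul.
    assert (Cnorm (Cexp (- mu * RtoC x))%Cx <= 1)
      by (apply Cnorm_Cexp_le_1; unfold Cre in *; simpl; nra).
    apply Rle_trans with (1 * (eps / (2 * (w - u)))); [| lra].
    apply Rmult_le_compat; try apply Cnorm_ge0; [assumption | lra].
Qed.

Lemma exp_neg_le_inv y : 0 < y -> exp (- y) <= / y.
Proof.
  intros Hy; rewrite exp_Ropp; apply Rinv_le_contravar; [exact Hy |].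
  assert (H := exp_ineq1 y ltac:(lra)); lra.
Qed.

(* Dominated convergence in finite form: [a] is small on the head, and [b] is
   a summable majorant that takes care of the tail. *)
Lemma sum_split_le (t a b : nat -> R) l N0 N :
  (forall n, 0 <= a n) -> (forall n, 0 <= b n) ->
  (forall n, t n <= a n) -> (forall n, t n <= b n) ->
  Un_cv (sum_f_R0 b) l -> (N0 <= N)%nat ->
  sum_f_R0 t N <= sum_f_R0 a N0 + (l - sum_f_R0 b N0).
Proof.
  intros Ha Hb Hta Htb Hl HN.
  assert (L : sum_f_R0 b N <= l).
  { apply (growing_ineq (sum_f_R0 b)); [| exact Hl].
    intros n; simpl; specialize (Hb (S n)); lra. }
  enough (sum_f_R0 t N <= sum_f_R0 a N0 + (sum_f_R0 b N - sum_f_R0 b N0)) by lra.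
  clear L; induction HN as [|N HN IH].
  - assert (sum_f_R0 t N0 <= sum_f_R0 a N0) by (apply sum_Rle; intros; apply Hta). lra.
  - simpl; specialize (Htb (S N)); lra.
Qed.

(** Since [Re (e n) >= m (n + 1)], the summable [b] majorizes [|A_n / e n|], which gives the limit
    [L]. The same [b] controls the effect of the cuts at [u] and [w], uniformly in the number [N] of
    terms. *)
Lemma exp_binom_integral v c mu : Cre v < 1 -> 0 < Cre c -> 0 < Cre mu ->
  exists L, Cseries_cv (fun n => binc v n / (mu + RtoC 2 * RtoC (INR n) * c))%Cx L /\
    improper_CRInt (exp_binom v c mu) L.
Proof.
  intros Hv Hc Hmu.
  set (m := Rmin (Cre mu) (2 * Cre c)).
  assert (Hm : 0 < m) by (apply Rmin_glb_lt; lra).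
  set (e := fun n => (mu + RtoC 2 * RtoC (INR n) * c)%Cx).
  set (b := fun n => / m * (Cnorm (binc v n) / INR (S n))).
  assert (Hfe : forall n, m * INR (S n) <= fst (e n)) by (intros; now apply fst_exponent_ge).
  assert (HS : forall n, 0 < INR (S n)) by (intros; apply lt_0_INR; lia).
  assert (Hfe0 : forall n, 0 < m * INR (S n)) by (intros; now apply Rmult_lt_0_compat).
  assert (He0 : forall n, e n <> RtoC 0).
  { intros n; apply fst_neq0; specialize (Hfe n); specialize (Hfe0 n); lra. }
  assert (Hu : forall n, Cnorm (binc v n / e n)%Cx <= b n).
  { intros n; rewrite Cnorm_div by apply He0; unfold b.
    replace (/ m * (Cnorm (binc v n) / INR (S n)))
      with (Cnorm (binc v n) / (m * INR (S n)))
      by (field; split; [specialize (HS n) |]; lra).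
    apply Rmult_le_compat_l; [apply Cnorm_ge0 |].
    apply Rinv_le_contravar; [apply Hfe0 |].
    eapply Rle_trans; [apply Hfe |]; eapply Rle_trans; [apply Rle_abs | apply Rabs_fst_le]. }
  assert (Hb : forall n, 0 <= b n)
    by (intros n; eapply Rle_trans; [apply Cnorm_ge0 | apply Hu]).
  destruct (binc_summable v Hv) as [K HK].
  assert (HbK : forall n, sum_f_R0 b n <= / m * K).
  { intros n.
    replace (sum_f_R0 b n) with (/ m * sum_f_R0 (fun n => Cnorm (binc v n) / INR (S n)) n).
    - apply Rmult_le_compat_l; [left; now apply Rinv_0_lt_compat | apply HK].
    - rewrite scal_sum; apply sum_eq; intros; unfold b; ring. }
  destruct (Cseries_cv_abs _ b _ Hu HbK) as [L HL]; exists L; split; [exact HL |].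
  destruct (bounded_sum_cv b _ Hb HbK) as [l Hl].
  assert (Hl0 : forall n, sum_f_R0 b n <= l).
  { intros n; apply (growing_ineq (sum_f_R0 b)); [| exact Hl].
    intros k; simpl; specialize (Hb (S k)); lra. }
  intros eps Heps.
  destruct (Hl (eps / 20) ltac:(lra)) as [N0 HN0].
  specialize (HN0 N0 (Nat.le_refl _)).
  assert (Htail : l - sum_f_R0 b N0 <= eps / 20).
  { unfold Rdist in HN0; rewrite Rabs_minus_sym in HN0.
    eapply Rle_trans; [apply Rle_abs | left; exact HN0]. }
  set (A := sum_f_R0 (fun n => Cnorm (binc v n)) N0).
  assert (HA : 0 <= A) by (apply cond_pos_sum; intros; apply Cnorm_ge0).
  assert (Hl1 : 0 <= l) by (eapply Rle_trans; [apply (Hb 0%nat) | apply (Hl0 0%nat)]).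
  assert (Hmu' : 0 < fst mu) by exact Hmu.
  (* The first keeps the head [2 u A] below [eps / 10]; the second, with [e^(-y) <= 1/y], keeps
     [l e^(-Re(mu) w)] below [eps / 20]. *)
  exists (eps / (20 * (A + 1))), (20 * (l + 1) / (Cre mu * eps)).
  split; [apply Rdiv_lt_0_compat; lra |].
  split; [apply Rdiv_lt_0_compat; [lra | now apply Rmult_lt_0_compat] |].
  intros u w Hu0 Hud HMw Huw.
  destruct (ex_derive_exp_binom v c mu Hc) as [f' Hf'].
  destruct (ex_CRInt (exp_binom v c mu) f' u w ltac:(lra)) as [I HI];
    [intros x Hx; apply Hf'; lra |].
  exists I; split; [exact HI |].
  destruct (exp_binom_RInt v c mu u w I (eps / 4) Hv Hc Hmu) as [N1 HN1];
    [lra | exact HI | lra |].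
  destruct (Cseries_cv_Cnorm _ _ (eps / 4) HL ltac:(lra)) as [N2 HN2].
  (* This [N] may depend on [u] and [w] through [N1], whereas [N0], on which the first cut was
     based, does not. *)
  set (N := max N0 (max N1 N2)).
  specialize (HN1 N ltac:(lia)); specialize (HN2 N ltac:(lia)); fold e in HN2.
  set (J := fun n => (binc v n * ((Cexp (- e n * RtoC u) - Cexp (- e n * RtoC w)) / e n))%Cx).
  change (Cnorm (I - Cpartial J N)%Cx <= eps / 4) in HN1.
  set (U := fun n => (binc v n / e n)%Cx) in *.
  change (Cnorm (Cpartial U N - L)%Cx < eps / 4) in HN2.
  assert (EJ : Cpartial J N = (Cpartial U N
    + (Cpartial (fun n => U n * (Cexp (- e n * RtoC u) - RtoC 1)) N
       + Cpartial (fun n => RtoC (-1) * (U n * Cexp (- e n * RtoC w))) N))%Cx).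
  { rewrite <- !Cpartial_add; apply Cpartial_ext; intros n; unfold U, J.
    replace (RtoC (-1)) with (- RtoC 1)%Cx by (apply Cpx_eq; simpl; ring).
    field; apply He0. }
  (* Up to [N0] the bound [|e^(-e n u) - 1| <= 2 |e n| u] cancels the denominator [e n]; beyond [N0]
     the bound 2 leaves the tail of [2 b]. *)
  assert (S1 : Cnorm (Cpartial (fun n => U n * (Cexp (- e n * RtoC u) - RtoC 1)) N)%Cx
    <= sum_f_R0 (fun n => Cnorm (binc v n) * (2 * u)) N0
       + (2 * l - sum_f_R0 (fun n => b n * 2) N0)).
  { eapply Rle_trans; [apply Cnorm_Cpartial_le; intros k; apply Rle_refl |].
    assert (Hre : forall n, fst (- e n * RtoC u)%Cx <= 0).
    { intros n; specialize (Hfe n); specialize (Hfe0 n).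
      change (- fst (e n) * u - - snd (e n) * 0 <= 0); nra. }
    apply sum_split_le; [intros n | intros n | intros n | intros n | | lia].
    - apply Rmult_le_pos; [apply Cnorm_ge0 | lra].
    - specialize (Hb n); lra.
    - unfold U; rewrite Cnorm_mul, Cnorm_div by apply He0.
      eapply Rle_trans; [apply Rmult_le_compat_l; [| apply Cnorm_one_sub_Cexp_le, Hre] |].
      + apply Rmult_le_pos; [apply Cnorm_ge0 |].
        left; apply Rinv_0_lt_compat, Cnorm_gt0, He0.
      + rewrite Cnorm_mul, Cnorm_opp, Cnorm_RtoC, Rabs_pos_eq by lra.
        right; field; apply Rgt_not_eq, Cnorm_gt0, He0.
    - rewrite Cnorm_mul; apply Rmult_le_compat; try apply Cnorm_ge0; [apply Hu |].
      eapply Rle_trans; [apply Cnorm_triangle |].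
      rewrite Cnorm_opp, Cnorm_RtoC, Rabs_R1.
      assert (H := Cnorm_Cexp_le_1 _ (Hre n)); lra.
    - eapply Un_cv_ext; [| apply (Un_cv_scal 2), Hl].
      intros n; simpl; now rewrite scal_sum. }
  assert (S2 : Cnorm (Cpartial (fun n => RtoC (-1) * (U n * Cexp (- e n * RtoC w))) N)%Cx
    <= exp (- (Cre mu * w)) * l).
  { apply Rle_trans with (sum_f_R0 (fun n => b n * exp (- (Cre mu * w))) N).
    - apply Cnorm_Cpartial_le; intros n.
      rewrite !Cnorm_mul, Cnorm_RtoC.
      replace (Rabs (-1)) with 1 by (rewrite Rabs_left; lra); rewrite Rmult_1_l.
      apply Rmult_le_compat; try apply Cnorm_ge0; [apply Hu |].
      rewrite Cnorm_exp.
      assert (E : fst (- e n * RtoC w)%Cx <= - (Cre mu * w)).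
      { unfold e, Cre in *; assert (P := pos_INR n); simpl.
        assert (0 <= INR n * fst c * w) by (repeat apply Rmult_le_pos; lra). nra. }
      destruct E as [E | E]; [left; now apply exp_increasing | right; now rewrite E].
    - rewrite <- scal_sum; apply Rmult_le_compat_l; [left; apply exp_pos | apply Hl0]. }
  assert (T1 : sum_f_R0 (fun n => Cnorm (binc v n) * (2 * u)) N0 <= eps / 10).
  { rewrite <- scal_sum; fold A.
    assert (u * (20 * (A + 1)) <= eps).
    { apply (Rmult_lt_compat_r (20 * (A + 1))) in Hud; [| lra].
      replace (eps / (20 * (A + 1)) * (20 * (A + 1))) with eps in Hud by (field; lra).
      lra. }
    nra. }
  assert (T2 : 2 * l - sum_f_R0 (fun n => b n * 2) N0 <= eps / 10)
    by (rewrite <- scal_sum; lra).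
  assert (T3 : exp (- (Cre mu * w)) * l <= eps / 20).
  { assert (Hw : 0 < Cre mu * w) by (apply Rmult_lt_0_compat; lra).
    assert (E : 20 * (l + 1) <= eps * (Cre mu * w)).
    { apply (Rmult_lt_compat_r (Cre mu * eps)) in HMw; [| now apply Rmult_lt_0_compat].
      replace (20 * (l + 1) / (Cre mu * eps) * (Cre mu * eps)) with (20 * (l + 1)) in HMw
        by (field; split; lra).
      lra. }
    apply Rle_trans with (/ (Cre mu * w) * l).
    - apply Rmult_le_compat_r; [exact Hl1 | now apply exp_neg_le_inv].
    - apply Rmult_le_reg_l with (1 := Hw); rewrite <- Rmult_assoc, Rinv_r by lra; lra. }
  (* The four errors are at most [eps/4], [eps/4], [eps/10 + eps/10] and [eps/20]. *)
  replace (I - L)%Cx with ((I - Cpartial J N) + ((Cpartial U N - L)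
    + (Cpartial (fun n => U n * (Cexp (- e n * RtoC u) - RtoC 1)) N
       + Cpartial (fun n => RtoC (-1) * (U n * Cexp (- e n * RtoC w))) N)))%Cx
    by (rewrite EJ; ring).
  eapply Rle_lt_trans; [apply Cnorm_triangle |].
  eapply Rle_lt_trans; [apply Rplus_le_compat_l, Cnorm_triangle |].
  eapply Rle_lt_trans; [apply Rplus_le_compat_l, Rplus_le_compat_l, Cnorm_triangle |].
  lra.
Qed.

(** * Pochhammer symbols and the general hypergeometric term *)

Lemma Cmul_neq0 z w : z <> RtoC 0 -> w <> RtoC 0 -> (z * w)%Cx <> RtoC 0.
Proof. exact (Cmult_neq_0 z w). Qed.

Lemma Cpow_rhp (z w : Cpx) : 0 < fst z -> Cpow z w = Cexp (w * Clog_rhp z)%Cx.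
Proof.
  intros H; unfold Cpow; rewrite Clog_eq by exact H.
  destruct (Req_EM_T (fst z) 0); [lra | reflexivity].
Qed.

(** Both sides are [z(z + 1)...(z + n)]. *)
Lemma poch_succ z n : (poch (RtoC 1 + z) n * z = poch z n * (z + RtoC (INR n)))%Cx.
Proof.
  induction n as [|n IH]; simpl poch.
  - change (INR 0) with 0; ring.
  - rewrite RtoC_S; set (p := poch (RtoC 1 + z)%Cx n) in *.
    replace (p * (RtoC 1 + z + RtoC (INR n)) * z)%Cx
      with (p * z * (RtoC 1 + z + RtoC (INR n)))%Cx by ring.
    rewrite IH; ring.
Qed.

Lemma add_nat_neq0 z n : not_Z0neg z -> (z + RtoC (INR n))%Cx <> RtoC 0.
Proof.
  intros H E; apply (H n).
  replace z with ((z + RtoC (INR n)) - RtoC (INR n))%Cx by ring.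
  rewrite E; apply Cpx_eq; simpl; ring.
Qed.

Lemma not_Z0neg_neq0 z : not_Z0neg z -> z <> RtoC 0.
Proof.
  intros H E; apply (add_nat_neq0 z 0 H); rewrite E; change (INR 0) with 0; ring.
Qed.

Lemma poch_neq0 z n : not_Z0neg z -> poch z n <> RtoC 0.
Proof.
  intros H; induction n as [|n IH]; simpl; [apply RtoC_neq0; lra |].
  apply Cmul_neq0; [exact IH | now apply add_nat_neq0].
Qed.

Lemma poch_up z n : z <> RtoC 0 ->
  poch (RtoC 1 + z)%Cx n = (poch z n * ((z + RtoC (INR n)) / z))%Cx.
Proof.
  intros H; transitivity (poch (RtoC 1 + z) n * z / z)%Cx; [field; exact H |].
  rewrite poch_succ; field; exact H.
Qed.

Lemma poch_down z n : (z + RtoC (INR n))%Cx <> RtoC 0 ->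
  poch z n = (poch (RtoC 1 + z) n * (z / (z + RtoC (INR n))))%Cx.
Proof.
  intros H; transitivity (poch z n * (z + RtoC (INR n)) / (z + RtoC (INR n)))%Cx;
    [field; exact H |].
  rewrite <- poch_succ; field; exact H.
Qed.

Lemma Cpown_1 n : Cpown (RtoC 1) n = RtoC 1.
Proof. induction n as [|n IH]; simpl; [| rewrite IH]; ring. Qed.

Lemma hyper_term_8F7 v l0 l1 l2 s3 s4 s5 s6 n :
  not_Z0neg l0 -> not_Z0neg l1 -> not_Z0neg l2 ->
  not_Z0neg (RtoC 1 + s3)%Cx -> not_Z0neg (RtoC 1 + s4)%Cx ->
  not_Z0neg (RtoC 1 + s5)%Cx -> not_Z0neg (RtoC 1 + s6)%Cx ->
  (s3 + RtoC (INR n))%Cx <> RtoC 0 -> (s4 + RtoC (INR n))%Cx <> RtoC 0 ->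
  (s5 + RtoC (INR n))%Cx <> RtoC 0 -> (s6 + RtoC (INR n))%Cx <> RtoC 0 ->
  hyper_term [v; (RtoC 1 + l0)%Cx; (RtoC 1 + l1)%Cx; (RtoC 1 + l2)%Cx; s3; s4; s5; s6]
    [l0; l1; l2; (RtoC 1 + s3)%Cx; (RtoC 1 + s4)%Cx; (RtoC 1 + s5)%Cx; (RtoC 1 + s6)%Cx]
    (RtoC 1) n =
  (binc v n
   * (((l0 + RtoC (INR n)) / l0) * (((l1 + RtoC (INR n)) / l1) * ((l2 + RtoC (INR n)) / l2)))
   * ((s3 / (s3 + RtoC (INR n))) * (s4 / (s4 + RtoC (INR n)))
      * (s5 / (s5 + RtoC (INR n))) * (s6 / (s6 + RtoC (INR n)))))%Cx.
Proof.
  intros H0 H1 H2 H3 H4 H5 H6 N3 N4 N5 N6.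
  unfold hyper_term, prod_poch, fold_right, binc.
  rewrite Cpown_1.
  rewrite !poch_up by now apply not_Z0neg_neq0.
  rewrite (poch_down s3), (poch_down s4), (poch_down s5), (poch_down s6) by assumption.
  apply (poch_neq0 _ n) in H3, H4, H5, H6.
  assert (P0 := poch_neq0 _ n H0); assert (P1 := poch_neq0 _ n H1);
    assert (P2 := poch_neq0 _ n H2).
  apply not_Z0neg_neq0 in H0, H1, H2.
  assert (F := RtoC_INR_neq0 _ (fact_neq_0 n)).
  (* With the symbols abstracted, what remains is a rational identity in nonzero atoms. *)
  generalize dependent (poch (RtoC 1 + s3)%Cx n); intros q3 H3.
  generalize dependent (poch (RtoC 1 + s4)%Cx n); intros q4 H4.
  generalize dependent (poch (RtoC 1 + s5)%Cx n); intros q5 H5.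
  generalize dependent (poch (RtoC 1 + s6)%Cx n); intros q6 H6.
  generalize dependent (poch l0 n); intros p0 P0.
  generalize dependent (poch l1 n); intros p1 P1.
  generalize dependent (poch l2 n); intros p2 P2.
  generalize dependent (RtoC (INR (fact n))); intros f F.
  field; repeat split; assumption.
Qed.

(** * Partial fractions, the integrand, and the theorem *)

Lemma RtoC_2 : RtoC 2 = (RtoC 1 + RtoC 1)%Cx.
Proof. apply Cpx_eq; simpl; ring. Qed.

Lemma sum_inv_sign_combinations w a b :
  (w - a - b)%Cx <> RtoC 0 -> (w + a + b)%Cx <> RtoC 0 ->
  (w - a + b)%Cx <> RtoC 0 -> (w + a - b)%Cx <> RtoC 0 ->
  (RtoC 1 / (w - a - b) + RtoC 1 / (w + a + b)
   + RtoC 1 / (w - a + b) + RtoC 1 / (w + a - b) =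
   RtoC 2 * RtoC 2 * (w * (w * w - a * a - b * b))
   / ((w - a - b) * (w + a + b) * (w - a + b) * (w + a - b)))%Cx.
Proof.
  intros H1 H2 H3 H4; rewrite RtoC_2; field; repeat split; assumption.
Qed.

Lemma integrand_exp_binom v a b c x : 0 < Cre c -> 0 < x ->
  (Cpow (RtoC 2) v / (RtoC 2 * RtoC 2)
   * (exp_binom v c (v * c - a - b) x + exp_binom v c (v * c + a + b) x
      + exp_binom v c (v * c - a + b) x + exp_binom v c (v * c + a - b) x))%Cx =
  (Ccosh (a * RtoC x) * Ccosh (b * RtoC x) / sinh_pow c v x)%Cx.
Proof.
  intros Hc Hx; unfold Ccosh, sinh_pow, exp_binom.
  assert (H2 : 0 < fst (RtoC 2)) by (simpl; lra).
  rewrite !(Cpow_rhp (RtoC 2)) by exact H2.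
  rewrite (Cpow_rhp (_ - _)%Cx) by now apply fst_one_sub_exp_pos.
  set (L := Clog_rhp (RtoC 2)).
  set (M := Clog_rhp (RtoC 1 - _)%Cx).
  replace (- (v * c - a - b) * RtoC x)%Cx
    with (- (v * (c * RtoC x)) + (a * RtoC x + b * RtoC x))%Cx by ring.
  replace (- (v * c + a + b) * RtoC x)%Cx
    with (- (v * (c * RtoC x)) + (- (a * RtoC x) + - (b * RtoC x)))%Cx by ring.
  replace (- (v * c - a + b) * RtoC x)%Cx
    with (- (v * (c * RtoC x)) + (a * RtoC x + - (b * RtoC x)))%Cx by ring.
  replace (- (v * c + a - b) * RtoC x)%Cx
    with (- (v * (c * RtoC x)) + (- (a * RtoC x) + b * RtoC x))%Cx by ring.
  replace (- v * M)%Cx with (- (v * M))%Cx by ring.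
  replace (- v * L)%Cx with (- (v * L))%Cx by ring.
  (* Only the exponentials of [ax], [bx], [vcx], [v L] and [v M] remain, as nonzero atoms for
     [field]. *)
  rewrite !Cexp_add, !Cexp_opp.
  field; repeat split; try apply Cexp_neq0; apply fst_neq0, H2.
Qed.

Theorem mainTheorem18 (v a b c s : Cpx) :
  Cre v < 1 -> 0 < Cre c ->
  0 < Cre (v * c + a + b)%Cx -> 0 < Cre (v * c + a - b)%Cx ->
  0 < Cre (v * c - a + b)%Cx -> 0 < Cre (v * c - a - b)%Cx ->
  (s * s = a * a + b * b)%Cx ->
  let two := RtoC 2 in
  let one := RtoC 1 in
  let lam1 := (v / two - s / (two * c))%Cx in
  let lam2 := (v / two + s / (two * c))%Cx in
  let sig3 := (v / two - a / (two * c) - b / (two * c))%Cx in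
  let sig4 := (v / two - a / (two * c) + b / (two * c))%Cx in
  let sig5 := (v / two + a / (two * c) + b / (two * c))%Cx in
  let sig6 := (v / two + a / (two * c) - b / (two * c))%Cx in
  let P := ((v * c - a - b) * (v * c + a + b) * (v * c - a + b) * (v * c + a - b))%Cx in
  not_Z0neg (v / two)%Cx -> not_Z0neg lam1 -> not_Z0neg lam2 ->
  not_Z0neg (one + sig3)%Cx -> not_Z0neg (one + sig4)%Cx ->
  not_Z0neg (one + sig5)%Cx -> not_Z0neg (one + sig6)%Cx ->
  exists S : Cpx,
    hyperF_eq [v; (one + v / two)%Cx; (one + lam1)%Cx; (one + lam2)%Cx; sig3; sig4; sig5; sig6]
              [(v / two)%Cx; lam1; lam2; (one + sig3)%Cx; (one + sig4)%Cx;
               (one + sig5)%Cx; (one + sig6)%Cx]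
              one S /\
    improper_int_0_inf
      (fun x => (Ccosh (a * RtoC x) * Ccosh (b * RtoC x) / sinh_pow c v x)%Cx)
      (Cpow two v * (v * v * v * c * c * c - a * a * v * c - b * b * v * c) / P * S)%Cx.
Proof.
  intros Hv Hc M2 M4 M3 M1 Hs two one lam1 lam2 sig3 sig4 sig5 sig6 P
    Zv Z1 Z2 Z3 Z4 Z5 Z6.
  assert (Hk : two <> RtoC 0) by (apply RtoC_neq0; lra).
  assert (Hc0 : c <> RtoC 0) by now apply fst_neq0.
  assert (Hv0 : v <> RtoC 0).
  { intros E; apply (not_Z0neg_neq0 _ Zv); rewrite E; field; exact Hk. }
  (* [Q = 4 c^2 lam1 lam2], so the hypotheses on [lam1] and [lam2] make it nonzero; the numerator of
     the prefactor is [vcQ]. *)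
  set (Q := (v * c * (v * c) - a * a - b * b)%Cx).
  assert (EQ : (lam1 * lam2 = Q / (two * c * (two * c)))%Cx).
  { transitivity ((v * c * (v * c) - s * s) / (two * c * (two * c)))%Cx;
      [unfold lam1, lam2; field; auto |].
    rewrite Hs; unfold Q; field; auto. }
  assert (HQ : Q <> RtoC 0).
  { intros E; apply (Cmul_neq0 _ _ (not_Z0neg_neq0 _ Z1) (not_Z0neg_neq0 _ Z2)).
    rewrite EQ, E; field; auto. }
  destruct (exp_binom_integral v c _ Hv Hc M1) as [L1 [S1 I1]].
  destruct (exp_binom_integral v c _ Hv Hc M2) as [L2 [S2 I2]].
  destruct (exp_binom_integral v c _ Hv Hc M3) as [L3 [S3 I3]].
  destruct (exp_binom_integral v c _ Hv Hc M4) as [L4 [S4 I4]].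
  assert (D : forall mu n, 0 < Cre mu -> (mu + two * RtoC (INR n) * c)%Cx <> RtoC 0).
  { intros mu n Hmu; apply fst_neq0; eapply Rlt_le_trans; [| now apply fst_exponent_ge].
    apply Rmult_lt_0_compat; [apply Rmin_glb_lt; lra | apply lt_0_INR; lia]. }
  assert (HP : P <> RtoC 0) by (repeat apply Cmul_neq0; now apply fst_neq0).
  (* Forced by the prefactor: [2^v vcQ / P] times this value must be [2^v / 4] times the sum of the
     four integrals. *)
  exists (P / (two * two * (v * c * Q)) * (L1 + L2 + L3 + L4))%Cx; split.
  - apply Cseries_cv_ext with (2 := Cseries_cv_scal _ _ _
      (Cseries_cv_add _ _ _ _ (Cseries_cv_add _ _ _ _ (Cseries_cv_add _ _ _ _ S1 S2) S3) S4)).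
    intros n; set (m := RtoC (INR n)).
    set (w := ((v + two * m) * c)%Cx).
    assert (E1 : (v * c - a - b + two * m * c = w - a - b)%Cx) by (unfold w; ring).
    assert (E2 : (v * c + a + b + two * m * c = w + a + b)%Cx) by (unfold w; ring).
    assert (E3 : (v * c - a + b + two * m * c = w - a + b)%Cx) by (unfold w; ring).
    assert (E4 : (v * c + a - b + two * m * c = w + a - b)%Cx) by (unfold w; ring).
    assert (N1 := D _ n M1); assert (N2 := D _ n M2);
      assert (N3 := D _ n M3); assert (N4 := D _ n M4).
    fold m two in N1, N2, N3, N4 |- *.
    rewrite E1 in *; rewrite E2 in *; rewrite E3 in *; rewrite E4 in *.
    assert (F3 : (sig3 + m = (w - a - b) / (two * c))%Cx)
      by (unfold sig3, w; field; auto).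
    assert (F4 : (sig4 + m = (w - a + b) / (two * c))%Cx)
      by (unfold sig4, w; field; auto).
    assert (F5 : (sig5 + m = (w + a + b) / (two * c))%Cx)
      by (unfold sig5, w; field; auto).
    assert (F6 : (sig6 + m = (w + a - b) / (two * c))%Cx)
      by (unfold sig6, w; field; auto).
    assert (Hd : forall z, z <> RtoC 0 -> (z / (two * c))%Cx <> RtoC 0).
    { intros z Hz E; apply Hz; replace z with (z / (two * c) * (two * c))%Cx by (field; auto).
      rewrite E; ring. }
    symmetry; rewrite hyper_term_8F7; try assumption; fold m;
      try (rewrite ?F3, ?F4, ?F5, ?F6; now apply Hd).
    (* [lam1 + m] and [lam2 + m] are [(w - s)/(2c)] and [(w + s)/(2c)]; only [s^2] survives in their
       product, so the choice of the root is immaterial. *)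
    assert (EW : ((lam1 + m) / lam1 * ((lam2 + m) / lam2) = (w * w - a * a - b * b) / Q)%Cx).
    { transitivity (((w * w - s * s) / (two * c * (two * c))) / (lam1 * lam2))%Cx.
      - apply not_Z0neg_neq0 in Z1, Z2.
        transitivity (((lam1 + m) * (lam2 + m)) / (lam1 * lam2))%Cx; [field; auto |].
        f_equal; unfold lam1, lam2, w; field; auto.
      - rewrite EQ, Hs; field; auto. }
    rewrite EW, F3, F4, F5, F6.
    transitivity (binc v n * (P / (two * two * (v * c * Q)))
      * (RtoC 1 / (w - a - b) + RtoC 1 / (w + a + b)
         + RtoC 1 / (w - a + b) + RtoC 1 / (w + a - b)))%Cx; [| field; repeat split; auto].
    rewrite sum_inv_sign_combinations by assumption; fold two.
    replace ((v / two + m) / (v / two))%Cx with (w / (v * c))%Cx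
      by (unfold w; field; auto).
    replace sig3 with ((v * c - a - b) / (two * c))%Cx by (unfold sig3; field; auto).
    replace sig4 with ((v * c - a + b) / (two * c))%Cx by (unfold sig4; field; auto).
    replace sig5 with ((v * c + a + b) / (two * c))%Cx by (unfold sig5; field; auto).
    replace sig6 with ((v * c + a - b) / (two * c))%Cx by (unfold sig6; field; auto).
    unfold P; clearbody Q w two; field; repeat split; auto.
  - apply improper_CRInt_int_0_inf.
    apply improper_CRInt_ext with (1 := fun x => integrand_exp_binom v a b c x Hc).
    replace (Cpow two v * (v * v * v * c * c * c - a * a * v * c - b * b * v * c) / P *
      (P / (two * two * (v * c * Q)) * (L1 + L2 + L3 + L4)))%Cx
      with (Cpow two v / (two * two) * (L1 + L2 + L3 + L4))%Cx.
    + apply improper_CRInt_scal.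
      exact (improper_CRInt_add _ _ _ _ (improper_CRInt_add _ _ _ _
        (improper_CRInt_add _ _ _ _ I1 I2) I3) I4).
    + replace (v * v * v * c * c * c - a * a * v * c - b * b * v * c)%Cx
        with (v * c * Q)%Cx by (unfold Q; ring).
      clearbody Q P two; field; auto.
Qed.
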